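(* Let $\mathcal{T}$ be a DDFV mesh of $\Omega$ (with diamond mesh $\mathfrak{D}$ and regularity bound $\theta^\star$), let $N_T\ge 1$ be an integer and $\Delta t=T/N_T$, and let $u_{\mathcal T}^0$ be the discretization of $u_0$. For all $n\ge 0$, there exists a solution $u_{\mathcal T}^{n+1}\in(\mathbb{R}_+^\ast)^{\mathcal T}$ to the nonlinear system $$\Bigl\llbracket \tfrac{u_{\mathcal T}^{n+1}-u_{\mathcal T}^n}{\Delta t},\psi_{\mathcal T}\Bigr\rrbracket_{\mathcal T}+T_{\mathfrak D}(u_{\mathcal T}^{n+1};g_{\mathcal T}^{n+1},\psi_{\mathcal T})+\kappa\,\bigl\llbracket \mathcal{P}^{\mathcal T}g_{\mathcal T}^{n+1},\psi_{\mathcal T}\bigr\rrbracket_{\mathcal T}=0\quad\forall \psi_{\mathcal T}\in\mathbb{R}^{\mathcal T},\qquad g_{\mathcal T}^{n+1}=\log(u_{\mathcal T}^{n+1})+V_{\mathcal T}$$ (so that, starting from $u^0_{\mathcal T}$, one obtains a sequence $(u_{\mathcal T}^n)_{n\ge 1}$ of solutions), that satisfies the discrete entropy/entropy dissipation estimate $$\frac{\mathbb{E}_{\mathcal T}^{n+1}-\mathbb{E}_{\mathcal T}^n}{\Delta t}+\mathbb{I}_{\mathcal T}^{n+1}\le 0,\qquad \forall n\ge 0.$$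
   Context: **Data.** $\Omega\subset\mathbb{R}^2$ is a polygonal connected open bounded set, $T>0$. $H(s)=s\log s-s+1$ for $s\ge0$ (with $0\log 0=0$). (A1) $u_0:\Omega\to\mathbb{R}$ is measurable, nonnegative, $\int_\Omega u_0\,dx>0$ and $\int_\Omega H(u_0)\,dx<\infty$. (A2) $V\in C^1(\overline\Omega,\mathbb{R})$ and $V\ge0$. (A3) $\Lambda\in L^\infty(\Omega)^{2\times2}$ is symmetric a.e. and there are $\lambda_m,\lambda^M>0$ with $\lambda_m|v|^2\le\Lambda(x)v\cdot v\le\lambda^M|v|^2$ for all $v\in\mathbb{R}^2$ and a.e. $x\in\Omega$. $\mathbb{R}_+^\ast=(0,\infty)$. **DDFV mesh.** The primal mesh $\overline{\mathfrak M}=\mathfrak M\cup\partial\mathfrak M$ consists of a partition $\mathfrak M$ of $\Omega$ into polygonal cells and of the set $\partial\mathfrak M$ of boundary edges, seen as degenerate cells. Each $K\in\overline{\mathfrak M}$ has a center $x_K$. To each vertex $x_{K^*}$ of the primal mesh is associated a dual cell $K^*$: if $x_{K^*}$ is interior, $K^*$ is the polygon with vertices $\{x_K: K\in\mathfrak M,\ x_{K^*}\in\overline K\}$ (these form $\mathfrak M^*$); if $x_{K^*}\in\partial\Omega$, $K^*$ is the polygon with vertices $\{x_{K^*}\}\cup\{x_K: K\in\overline{\mathfrak M},\ x_{K^*}\in\overline K\}$ (these form $\partial\mathfrak M^*$). $\overline{\mathfrak M^*}=\mathfrak M^*\cup\partial\mathfrak M^*$. Neighboring primal cells $K,L\in\overline{\mathfrak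 M}$ share an edge $\sigma=K|L$ (a segment; for a boundary edge, $L=\sigma\in\partial\mathfrak M$). For each primal edge $\sigma=K|L=(x_{K^*},x_{L^*})$ and dual edge $\sigma^*=K^*|L^*=(x_K,x_L)$, the diamond $\mathcal D=\mathcal D_{\sigma,\sigma^*}$ is the quadrilateral with diagonals $\sigma,\sigma^*$ (a triangle if $\sigma\subset\partial\Omega$). The set $\mathfrak D$ of diamonds is a partition of $\Omega$. $\mathcal T=(\overline{\mathfrak M},\overline{\mathfrak M^*})$. Notation: $m_K,m_{K^*},m_{\mathcal D}$, $m_{K\cap K^*}$, $m_{\mathcal D\cap K}$, etc. are areas; $m_\sigma,m_{\sigma^*}$ lengths; $d_{\mathcal D}$ is the diameter of $\mathcal D$; $\alpha_{\mathcal D}$ is the angle between $(x_K,x_L)$ and $(x_{K^*},x_{L^*})$; $m_{\mathcal D}=\frac12 m_\sigma m_{\sigma^*}\sin\alpha_{\mathcal D}$; $n_{\sigma K}$ is the unit normal to $\sigma$ outward to $K$, $n_{\sigma^*K^*}$ the unit normal to $\sigma^*$ outward to $K^*$; $\mathrm{size}(\mathcal T)=\max_{\mathcal D}d_{\mathcal D}$. Regularity factors: $\theta_{\mathcal D}=\frac{1}{2\sin\alpha_{\mathcal D}}\bigl(\frac{m_\sigma}{m_{\sigma^*}}+\frac{m_{\sigma^*}}{m_\sigma}\bigr)\ge 1$, and $\tilde\theta_{\mathcal D}$ is the maximum of $m_{\mathcal D}/m_{\mathcal D\cap K}$ and $m_{\mathcal D}/m_{\mathcal D\cap K^*}$ over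 the cells $K\in\mathfrak M$, $K^*\in\overline{\mathfrak M^*}$ meeting $\mathcal D$ in positive measure. It is assumed that $1\le\theta_{\mathcal D},\tilde\theta_{\mathcal D}\le\theta^\star$ for all $\mathcal D\in\mathfrak D$. **Discrete objects.** $\mathbb{R}^{\mathcal T}$ is the space of vectors $u_{\mathcal T}=((u_K)_{K\in\overline{\mathfrak M}},(u_{K^*})_{K^*\in\overline{\mathfrak M^*}})$; functions such as $\log$, $H$ are applied componentwise; $1_{\mathcal T}$ has all components $1$. $\llbracket v_{\mathcal T},u_{\mathcal T}\rrbracket_{\mathcal T}=\frac12\bigl(\sum_{K\in\mathfrak M}m_Ku_Kv_K+\sum_{K^*\in\overline{\mathfrak M^*}}m_{K^*}u_{K^*}v_{K^*}\bigr)$. For $\mathcal D\in\mathfrak D$ with vertices $x_K,x_L,x_{K^*},x_{L^*}$: $r^{\mathcal D}(u_{\mathcal T})=\frac14(u_K+u_L+u_{K^*}+u_{L^*})$, $\delta^{\mathcal D}u_{\mathcal T}=(u_K-u_L,\,u_{K^*}-u_{L^*})^T$, $\Lambda^{\mathcal D}=\frac1{m_{\mathcal D}}\int_{\mathcal D}\Lambda\,dx$, and $$\mathbb A^{\mathcal D}=\frac1{4m_{\mathcal D}}\begin{pmatrix}m_\sigma^2\,\Lambda^{\mathcal D}n_{\sigma K}\cdot n_{\sigma K}& m_\sigma m_{\sigma^*}\Lambda^{\mathcal D}n_{\sigma K}\cdot n_{\sigma^*K^*}\\ m_\sigma m_{\sigma^*}\Lambda^{\mathcal D}n_{\sigma K}\cdot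 n_{\sigma^*K^*}&m_{\sigma^*}^2\,\Lambda^{\mathcal D}n_{\sigma^*K^*}\cdot n_{\sigma^*K^*}\end{pmatrix}.$$ $T_{\mathfrak D}(u_{\mathcal T};g_{\mathcal T},\psi_{\mathcal T})=\sum_{\mathcal D\in\mathfrak D}r^{\mathcal D}(u_{\mathcal T})\,\delta^{\mathcal D}g_{\mathcal T}\cdot\mathbb A^{\mathcal D}\delta^{\mathcal D}\psi_{\mathcal T}$. For a fixed $\beta\in(0,2)$, the penalization operator $\mathcal P^{\mathcal T}:\mathbb{R}^{\mathcal T}\to\mathbb{R}^{\mathcal T}$ has components $\mathcal P_Ku_{\mathcal T}=\frac{1}{m_K\,\mathrm{size}(\mathcal T)^\beta}\sum_{K^*\in\overline{\mathfrak M^*}}m_{K\cap K^*}(u_K-u_{K^*})$ for $K\in\mathfrak M$, $0$ on $\partial\mathfrak M$, and $\mathcal P_{K^*}u_{\mathcal T}=\frac{1}{m_{K^*}\mathrm{size}(\mathcal T)^\beta}\sum_{K\in\mathfrak M}m_{K\cap K^*}(u_{K^*}-u_K)$ for $K^*\in\overline{\mathfrak M^*}$. $\kappa>0$ is a fixed parameter. **Discrete data.** $u_K^0=\frac1{m_K}\int_Ku_0\,dx$ for $K\in\mathfrak M$, $u_{K^*}^0=\frac1{m_{K^*}}\int_{K^*}u_0\,dx$ for $K^*\in\overline{\mathfrak M^*}$, $u^0_L=0$ for $L\in\partial\mathfrak M$; $V_K=V(x_K)$ for $K\in\overline{\mathfrak M}$, $V_{K^*}=V(x_{K^*})$ for $K^*\in\overline{\mathfrak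 M^*}$. **Energy and dissipation.** $\mathbb E_{\mathcal T}^n=\llbracket H(u_{\mathcal T}^n),1_{\mathcal T}\rrbracket_{\mathcal T}+\llbracket V_{\mathcal T},u_{\mathcal T}^n\rrbracket_{\mathcal T}$ for $n\ge0$, $\mathbb I_{\mathcal T}^n=T_{\mathfrak D}(u_{\mathcal T}^n;g_{\mathcal T}^n,g_{\mathcal T}^n)$ for $n\ge1$. *)

(* Defs.v *)
From HB Require Import structures.
From mathcomp Require Import all_boot all_order all_algebra.
From mathcomp Require Import all_classical all_reals all_analysis.

Set Implicit Arguments.
Unset Strict Implicit.
Unset Printing Implicit Defensive.

Import Order.TTheory GRing.Theory Num.Theory.
Import numFieldNormedType.Exports.

Local Open Scope classical_set_scope.
Local Open Scope ring_scope.

(* The library norm on [R * R] is the sup norm: it is used only for the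
   topology and for boundedness; lengths are Euclidean, through [enorm]. *)
Notation plane R := (R * R)%type.

Definition dot (R : realType) (v w : plane R) : R := v.1 * w.1 + v.2 * w.2.

Definition enorm (R : realType) (v : plane R) : R := Num.sqrt (dot v v).

Definition mxapp (R : realType) (A : 'M[R]_2) (v : plane R) : plane R :=
  (A 0 0 * v.1 + A 0 1 * v.2, A 1 0 * v.1 + A 1 1 * v.2).

Definition mx2 (R : realType) (a b c d : R) : 'M[R]_2 :=
  \matrix_(i < 2, j < 2)
    if i == 0 then (if j == 0 then a else b) else (if j == 0 then c else d).

Definition leb2 (R : realType) :
    {measure set (measurableTypeR R * measurableTypeR R)%type -> \bar R} :=
  (@lebesgue_measure R \x @lebesgue_measure R)%E.

Definition area (R : realType) (A : set (plane R)) : R := fine (leb2 R A).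

(* Lebesgue measurability (with respect to the completed sigma-algebra):
   the library's [measurable_fun] on [R * R] is Borel measurability.  The
   library integral, built from simple functions below the positive and
   negative parts, is the Lebesgue integral on this larger class too. *)
Definition lebesgue_measurable_fun (R : realType) (D : set (plane R))
    (f : plane R -> R) : Prop :=
  exists2 g : measurableTypeR R * measurableTypeR R -> R, measurable_fun D g &
    {ae leb2 R, forall x, D x -> f x = g x}.

Definition diameter (R : realType) (A : set (plane R)) : R :=
  sup [set enorm (x - y) | x in A & y in A].

Definition segment (R : realType) (p q : plane R) : set (plane R) :=
  [set p + t *: (q - p) | t in `[0, 1]].

Definition open_segment (R : realType) (p q : plane R) : set (plane R) :=
  [set p + t *: (q - p) | t in `]0, 1[].

Definition frontier (T : topologicalType) (A : set T) : set T :=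
  closure A `\` interior A.

(* [P] is the open polygon whose successive vertices are those of [s], read
   cyclically: the sides form a simple closed curve and [P] is a bounded
   connected open set with this curve as frontier, hence its interior.  A flat
   angle at a vertex is allowed. *)
Record is_polygon (R : realType) (s : seq (plane R)) (P : set (plane R)) :
    Prop := IsPolygon {
  polygon_size : (3 <= size s)%N;
  polygon_uniq : uniq s;
  polygon_vertex : forall p q, p \in s -> q \in s ->
    ~ open_segment p (next s p) q;
  polygon_simple : forall p q, p \in s -> q \in s -> p != q ->
    open_segment p (next s p) `&` open_segment q (next s q) = set0;
  polygon_open : open P;
  polygon_nonempty : P !=set0;
  polygon_bounded : bounded_set P;
  polygon_connected : connected P;
  polygon_frontier :
    frontier P = \bigcup_(p in [set` s]) segment p (next s p) }.

Definition polygonal (R : realType) (Omega : set (plane R)) : Prop :=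
  exists s : seq (plane R * plane R),
    (forall pq, pq \in s -> pq.1 != pq.2) /\
    frontier Omega = \bigcup_(pq in [set` s]) segment pq.1 pq.2.

(* A partition, up to the frontiers of the (open) cells. *)
Definition is_partition (R : realType) (I : Type) (F : I -> set (plane R))
    (Omega : set (plane R)) : Prop :=
  [/\ forall i j, i <> j -> F i `&` F j = set0,
      forall i, F i `<=` Omega &
      Omega `<=` \bigcup_(i in setT) closure (F i)].

Definition outward_normal (R : realType) (n p q : plane R)
    (P : set (plane R)) : Prop :=
  [/\ dot n n = 1, dot n (q - p) = 0 &
      forall y, open_segment p q y ->
        \forall t \near 0^'+, P (y - t *: n) /\ ~ P (y + t *: n)].

(* [pcell] is the set of primal cells, [bedge] the set of boundary edges (the
   degenerate primal cells), [iedge] the set of interior primal edges and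
   [vertex] the set of vertices, which also indexes all the dual cells.
   Diamonds are indexed by the primal edges [iedge + bedge].  The edge [e] is
   oriented: it joins [eKs e] to [eLs e], and separates [eK e] from [eL e],
   which is the degenerate cell [b] when [e = inr b].  No quantity below
   depends on the choice of orientation, and the unit normals [nK], [nKs] are
   determined by their specifications. *)
Record ddfv_data (R : realType) := DdfvData {
  pcell : finType;
  bedge : finType;
  iedge : finType;
  vertex : finType;
  cell_set : pcell -> set (plane R);
  dual_set : vertex -> set (plane R);
  diam_set : iedge + bedge -> set (plane R);
  cell_center : pcell + bedge -> plane R;
  vpos : vertex -> plane R;
  eK : iedge + bedge -> pcell;
  iL : iedge -> pcell;
  eKs : iedge + bedge -> vertex;
  eLs : iedge + bedge -> vertex;
  nK : iedge + bedge -> plane R;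
  nKs : iedge + bedge -> plane R }.

Definition edge (R : realType) (m : ddfv_data R) : finType :=
  (iedge m + bedge m)%type.

Definition pcell_bar (R : realType) (m : ddfv_data R) : finType :=
  (pcell m + bedge m)%type.

Section Mesh.
Context {R : realType} {m : ddfv_data R}.
Implicit Types (e : edge m) (v : vertex m) (x y : pcell_bar m).

Definition eL e : pcell_bar m :=
  match e with inl i => inl (iL i) | inr b => inr b end.

Definition ends e : {set vertex m} := [set eKs e; eLs e]%SET.

Definition sides e : {set pcell_bar m} := [set inl (eK e); eL e]%SET.

Definition sigma e : set (plane R) := segment (vpos (eKs e)) (vpos (eLs e)).

Definition open_sigma e : set (plane R) :=
  open_segment (vpos (eKs e)) (vpos (eLs e)).

Definition closed_cell x : set (plane R) :=
  match x with
  | inl K => closure (cell_set K)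
  | inr b => sigma (inr b)
  end.

Definition neighbors_at v : rel (pcell_bar m) := fun x y =>
  [exists e : edge m, (v \in ends e) && (sides e == [set x; y]%SET)].

End Mesh.

Record is_ddfv_mesh (R : realType) (Omega : set (plane R)) (m : ddfv_data R) :
    Prop := IsDdfvMesh {
  vpos_inj : injective (@vpos R m);
  primal_partition : is_partition (@cell_set R m) Omega;
  (* the sides of the polygon K are the primal edges adjacent to K *)
  primal_polygon : forall K : pcell m, exists s : seq (vertex m),
    [/\ is_polygon (map (@vpos R m) s) (cell_set K),
        forall v, v \in s ->
          exists2 e : edge m, inl K \in sides e & ends e = [set v; next s v]%SET &
        forall e : edge m, inl K \in sides e ->
          exists2 v, v \in s & ends e = [set v; next s v]%SET];
  vertex_edge : forall v : vertex m, exists e : edge m, v \in ends e;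
  edge_ends : forall e : edge m, eKs e != eLs e;
  iedge_sides : forall i : iedge m, eK (inl i) != iL i;
  iedge_in : forall i : iedge m, open_sigma (inl i : edge m) `<=` Omega;
  bedge_in : forall b : bedge m, sigma (inr b : edge m) `<=` frontier Omega;
  edge_disjoint : forall e f : edge m, e != f ->
    open_sigma e `&` open_sigma f = set0;
  edge_vertex : forall (e : edge m) (v : vertex m), ~ open_sigma e (vpos v);
  center_cell : forall K : pcell m, cell_set K (cell_center (inl K));
  center_bedge : forall b : bedge m,
    open_sigma (inr b : edge m) (cell_center (inr b));
  (* the vertices of the polygon K* are the centers of the cells around the
     vertex, ordered by adjacency; on the boundary, the vertex itself is added *)
  dual_interior : forall v : vertex m, Omega (vpos v) ->
    exists s : seq (pcell_bar m),
      [/\ uniq s, forall x, (x \in s) <-> closed_cell x (vpos v),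
          cycle (neighbors_at v) s &
          is_polygon (map (@cell_center R m) s) (dual_set v)];
  dual_boundary : forall v : vertex m, frontier Omega (vpos v) ->
    exists s : seq (pcell_bar m),
      [/\ uniq s, forall x, (x \in s) <-> closed_cell x (vpos v),
          sorted (neighbors_at v) s &
          is_polygon (vpos v :: map (@cell_center R m) s) (dual_set v)];
  dual_sub : forall v : vertex m, dual_set v `<=` Omega;
  (* when [e] is a boundary edge, [cell_center (eL e)] lies on the edge and
     this quadrilateral is a triangle *)
  diamond_polygon : forall e : edge m,
    is_polygon [:: cell_center (inl (eK e)); vpos (eKs e);
                   cell_center (eL e); vpos (eLs e)] (diam_set e);
  diamond_partition : is_partition (@diam_set R m) Omega;
  nK_normal : forall e : edge m,
    outward_normal (nK e) (vpos (eKs e)) (vpos (eLs e)) (cell_set (eK e));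
  nKs_normal : forall e : edge m,
    outward_normal (nKs e) (cell_center (inl (eK e))) (cell_center (eL e))
      (dual_set (eKs e)) }.

Section Geometry.
Context {R : realType} {m : ddfv_data R}.
Implicit Types (e : edge m).

Definition m_sigma e : R := enorm (vpos (eLs e) - vpos (eKs e)).

Definition m_sigma_star e : R :=
  enorm (cell_center (eL e) - cell_center (inl (eK e))).

Definition m_cell (K : pcell m) : R := area (cell_set K).

Definition m_dual (v : vertex m) : R := area (dual_set v).

Definition m_cap (K : pcell m) (v : vertex m) : R :=
  area (cell_set K `&` dual_set v).

Definition m_diam e : R := area (diam_set e).

Definition alpha e : R :=
  acos (dot (cell_center (eL e) - cell_center (inl (eK e)))
            (vpos (eLs e) - vpos (eKs e)) / (m_sigma_star e * m_sigma e)).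

Definition theta e : R :=
  (2 * sin (alpha e))^-1 *
  (m_sigma e / m_sigma_star e + m_sigma_star e / m_sigma e).

Definition theta_tilde e : R :=
  Num.max
    (\big[Num.max/0]_(K : pcell m | 0 < area (diam_set e `&` cell_set K))
       (m_diam e / area (diam_set e `&` cell_set K)))
    (\big[Num.max/0]_(v : vertex m | 0 < area (diam_set e `&` dual_set v))
       (m_diam e / area (diam_set e `&` dual_set v))).

End Geometry.

Definition mesh_size (R : realType) (m : ddfv_data R) : R :=
  \big[Num.max/0]_(e : edge m) diameter (diam_set e).

Definition regular_mesh (R : realType) (m : ddfv_data R) (thetastar : R) :
    Prop :=
  forall e : edge m,
    (1 <= theta e <= thetastar) /\ (1 <= theta_tilde e <= thetastar).

Definition unknown (R : realType) (m : ddfv_data R) : finType :=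
  (pcell_bar m + vertex m)%type.

Definition unk_pos (R : realType) (m : ddfv_data R) (x : unknown m) : plane R :=
  match x with inl K => cell_center K | inr v => vpos v end.

Section Operators.
Context {R : realType} {m : ddfv_data R}.
Implicit Types (u v g psi : unknown m -> R) (e : edge m).

Definition dprod v u : R :=
  2^-1 * (\sum_(K : pcell m) m_cell K * u (inl (inl K)) * v (inl (inl K)) +
          \sum_(Ks : vertex m) m_dual Ks * u (inr Ks) * v (inr Ks)).

Definition rD u e : R :=
  4^-1 * (u (inl (inl (eK e))) + u (inl (eL e)) +
          u (inr (eKs e)) + u (inr (eLs e))).

Definition deltaD u e : plane R :=
  (u (inl (inl (eK e))) - u (inl (eL e)), u (inr (eKs e)) - u (inr (eLs e))).

Definition LambdaD (Lambda : plane R -> 'M[R]_2) e : 'M[R]_2 :=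
  \matrix_(i < 2, j < 2)
    ((m_diam e)^-1 * \int[leb2 R]_(x in diam_set e) (Lambda x i j)).

Definition AD (Lambda : plane R -> 'M[R]_2) e : 'M[R]_2 :=
  let L := LambdaD Lambda e in
  let offdiag :=
    m_sigma e * m_sigma_star e * dot (mxapp L (nK e)) (nKs e) in
  (4 * m_diam e)^-1 *:
    mx2 (m_sigma e ^+ 2 * dot (mxapp L (nK e)) (nK e)) offdiag
        offdiag (m_sigma_star e ^+ 2 * dot (mxapp L (nKs e)) (nKs e)).

Definition TD (Lambda : plane R -> 'M[R]_2) u g psi : R :=
  \sum_(e : edge m)
    rD u e * dot (deltaD g e) (mxapp (AD Lambda e) (deltaD psi e)).

Definition penalization (beta : R) u : unknown m -> R := fun x =>
  match x with
  | inl (inl K) => (m_cell K * mesh_size m `^ beta)^-1 *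
      \sum_(Ks : vertex m) m_cap K Ks * (u (inl (inl K)) - u (inr Ks))
  | inl (inr _) => 0
  | inr Ks => (m_dual Ks * mesh_size m `^ beta)^-1 *
      \sum_(K : pcell m) m_cap K Ks * (u (inr Ks) - u (inl (inl K)))
  end.

End Operators.

(* [ln 0 = 0], so that [entropyH 0 = 1]. *)
Definition entropyH (R : realType) (s : R) : R := s * ln s - s + 1.

Definition u_init (R : realType) (m : ddfv_data R) (u0 : plane R -> R) :
    unknown m -> R := fun x =>
  match x with
  | inl (inl K) => (m_cell K)^-1 * \int[leb2 R]_(y in cell_set K) (u0 y)
  | inl (inr _) => 0
  | inr Ks => (m_dual Ks)^-1 * \int[leb2 R]_(y in dual_set Ks) (u0 y)
  end.

Section Scheme.
Context {R : realType} {m : ddfv_data R}.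
Context (Lambda : plane R -> 'M[R]_2) (V : plane R -> R).
Context (kappa beta dt : R).
Implicit Types (u w psi : unknown m -> R).

Definition V_disc : unknown m -> R := fun x => V (unk_pos x).

Definition potential u : unknown m -> R := fun x => ln (u x) + V_disc x.

(* [w] is a solution in (0, +oo)^T of the system at the time step after [u]. *)
Definition scheme_step u w : Prop :=
  (forall x, 0 < w x) /\
  forall psi,
    dprod (fun x => (w x - u x) / dt) psi +
    TD Lambda w (potential w) psi +
    kappa * dprod (penalization beta (potential w)) psi = 0.

Definition energy u : R :=
  dprod (fun x => entropyH (u x)) (fun=> 1) + dprod V_disc u.

Definition dissipation u : R := TD Lambda u (potential u) (potential u).

Definition entropy_estimate u w : Prop :=
  (energy w - energy u) / dt + dissipation w <= 0.

End Scheme.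

Definition admissible_initial (R : realType) (Omega : set (plane R))
    (u0 : plane R -> R) : Prop :=
  [/\ lebesgue_measurable_fun Omega u0,
      forall x, Omega x -> 0 <= u0 x,
      (0 < \int[leb2 R]_(x in Omega) (u0 x)%:E)%E &
      (\int[leb2 R]_(x in Omega) (entropyH (u0 x))%:E < +oo)%E].

(* V is C^1 on the closure of Omega: continuous there, with partial derivatives
   in Omega extending continuously to the closure. *)
Definition C1_closure (R : realType) (Omega : set (plane R))
    (V : plane R -> R) : Prop :=
  {within closure Omega, continuous V} /\
  exists G1 G2 : plane R -> R,
    [/\ {within closure Omega, continuous G1},
        {within closure Omega, continuous G2},
        forall x, Omega x -> is_derive x ((1, 0) : plane R) V (G1 x) &
        forall x, Omega x -> is_derive x ((0, 1) : plane R) V (G2 x)].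

Definition admissible_potential (R : realType) (Omega : set (plane R))
    (V : plane R -> R) : Prop :=
  C1_closure Omega V /\ forall x, closure Omega x -> 0 <= V x.

Definition admissible_tensor (R : realType) (Omega : set (plane R))
    (Lambda : plane R -> 'M[R]_2) : Prop :=
  [/\ forall i j, lebesgue_measurable_fun Omega (fun x => Lambda x i j),
      exists M : R, {ae leb2 R, forall x, Omega x ->
        forall i j, `|Lambda x i j| <= M},
      {ae leb2 R, forall x, Omega x -> (Lambda x)^T = Lambda x} &
      exists lam Lam : R, [/\ 0 < lam, 0 < Lam &
        {ae leb2 R, forall x, Omega x -> forall v : plane R,
          lam * enorm v ^+ 2 <= dot (mxapp (Lambda x) v) v
            <= Lam * enorm v ^+ 2}]].

(* Main.v *)
(* With [g] as unknown and [u = exp (g - V)], one time step amounts to finding a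
   zero of a continuous map [F] on a finite dimensional space.  In [F g . g] the
   dissipation and the penalization are nonnegative, and each mass term
   [(exp (g - V) - u^n) g] is bounded below, with bounded sublevel sets when
   [u^n > 0].  Hence [F g . g <= 0] bounds [g] at one cell; the penalization
   propagates the bound to all cells, since the overlaps of primal and dual
   cells form a connected graph, and the dissipation propagates it to the
   boundary edges.  Such a coercive map has a zero.  This form of Brouwer's
   theorem is derived from Scarf's combinatorial lemma, applied to a grid of a
   simplex colored by the smallest component of the map.  The entropy estimate
   is the equation tested with [g], together with the convexity of [H]. *)
Require Import Defs.
From HB Require Import structures.
From mathcomp Require Import all_boot all_order all_algebra.
From mathcomp Require Import all_classical all_reals all_analysis.
From mathcomp Require Import measurable_realfun.
From mathcomp Require Import zify ring lra.

Set Implicit Arguments.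
Unset Strict Implicit.
Unset Printing Implicit Defensive.

Import Order.TTheory GRing.Theory Num.Theory.
Import numFieldNormedType.Exports.

(** * Scarf's lemma *)

(** The initial density may vanish on some cells, and where u vanishes the mass term tends to 0 as g
    tends to minus infinity: it gives no lower bound on g there. This is why the bound is taken at
    one cell where u is positive, then carried elsewhere. The penalization suits this because its
    weights do not depend on g and it couples the two families of cells; the dissipation only
    compares primal with primal and dual with dual values, with the weight [rD] that depends on g.
    Boundary edges carry neither mass nor penalization, but the weight of their diamond is at least
    a quarter of the density of the adjacent cell, which is bounded below by then. The overlap graph
    inherits its connectedness from [Omega]: two cells whose closures meet inside [Omega] share a
    vertex, and a cell overlaps the dual cell of each of its vertices. Scarf's lemma replaces
    triangulations by finitely many linear orders and a parity count; a passage to the limit then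
    turns grid points into a solution of a variational inequality. All constants may depend on the
    mesh, which is fixed. *)

Lemma odd_card_missing_color (X I : finType) (c : X -> I) (i0 : I)
    (b : {set X}) : #|b| = #|I| ->
  odd #|[set x in b | c @: (b :\ x) == [set~ i0]]| = (c @: b == [set: I]).
Proof.
move=> cb; set A := [set x in b | _].
have cD x : x \in b -> #|b :\ x| = #|[set~ i0]|.
  by move=> xb; move: (cardsD1 x b) (cardsC1 i0); rewrite xb cb => -> ->.
have cinj x : x \in A -> {in b :\ x &, injective c}.
  by rewrite inE => /andP[xb /eqP E]; apply/imset_injP; rewrite E cD.
(* If all colors occur, [c] is injective on [b] and only the element of color [i0] qualifies.
   Otherwise, as soon as some [x] qualifies, [c] is injective on [b :\ x] and the color of [x] is
   repeated by exactly one [x']; the two qualify and no other does. *)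
case: eqP => [E|nE].
  have inj : {in b &, injective c} by apply/imset_injP; rewrite E cardsT cb.
  have /imsetP[x xb xi0] : i0 \in c @: b by rewrite E inE.
  suff -> : A = [set x] by rewrite cards1.
  apply/setP => y; rewrite !inE; apply/andP/eqP => [[yb /eqP Ey]|->{y}].
    apply/eqP; apply: contraT => nyx.
    have : i0 \in c @: (b :\ y).
      by apply/imsetP; exists x => //; rewrite !inE eq_sym nyx xb.
    by rewrite Ey !inE eqxx.
  split=> //; apply/eqP/setP => i; rewrite !inE.
  apply/imsetP/idP => [[y]|nii0].
    rewrite !inE => /andP[nyx yb] ->; rewrite xi0.
    by apply: contra_neq nyx => /inj; exact.
  have /imsetP[y yb yi] : i \in c @: b by rewrite E inE.
  exists y => //; rewrite !inE yb andbT.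
  by apply: contra_neq nii0 => yx; rewrite yi yx -xi0.
case: (set_0Vmem A) => [->|[x xA]]; first by rewrite cards0.
have injx := cinj _ xA.
move: (xA); rewrite inE => /andP[xb /eqP Ex].
have nci : c x != i0.
  apply: contra_notN nE => /eqP cxi; apply/setP => i; rewrite inE.
  have [->|ni] := eqVneq i i0; first by rewrite -cxi imset_f.
  have : i \in c @: (b :\ x) by rewrite Ex !inE.
  by apply/fintype.subsetP/imsetS/subD1set.
have /imsetP[x'] : c x \in c @: (b :\ x) by rewrite Ex !inE.
rewrite !inE => /andP[nx'x x'b] cxx'.
suff -> : A = [set x; x'] by rewrite cards2 eq_sym nx'x.
apply/setP => y; rewrite !inE; apply/andP/orP => [[yb /eqP Ey]|].
  apply/orP; apply: contraT; rewrite negb_or => /andP[nyx nyx'].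
  have /imsetP[z] : c y \in c @: (b :\ y).
    rewrite Ey !inE; apply: contraT; rewrite negbK => /eqP cyi0.
    suff : i0 \in c @: (b :\ x) by rewrite Ex !inE eqxx.
    by apply/imsetP; exists y => //; rewrite !inE nyx.
  rewrite !inE => /andP[nzy zb] cyz.
  have yx : y \in b :\ x by rewrite !inE nyx.
  have [zx|nzx] := eqVneq z x.
    case/negP: nyx'; apply/eqP/injx => //; first by rewrite !inE nx'x.
    by rewrite -cxx' -zx.
  by case/negP: nzy; apply/eqP/esym/injx => //; rewrite !inE nzx.
case=> /eqP->; split=> //; first exact/eqP.
apply/eqP; rewrite -Ex; apply/setP => i; apply/imsetP/imsetP => -[z].
  rewrite !inE => /andP[nzx' zb] ->.
  have [->|nzx] := eqVneq z x; first by exists x'; rewrite // !inE nx'x.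
  by exists z => //; rewrite !inE nzx.
rewrite !inE => /andP[nzx zb] ->.
have [->|nzx'] := eqVneq z x'.
  by exists x; rewrite // !inE xb eq_sym nx'x.
by exists z => //; rewrite !inE nzx'.
Qed.

(* [s i] is a slack element attached to the color [i].  The rooms are the
   dominant sets of size [#|I|] and the doors their subsets with one element
   less. *)
Section Dominance.
Context {X I : finType} (K : I -> X -> nat) (s : I -> X).
Hypothesis K_inj : forall i, injective (K i).
Hypothesis s_min : forall i x, K i (s i) <= K i x.
Hypothesis s_max : forall i j x, i != j -> x \notin codom s -> K i x < K i (s j).

Definition low (b : {set X}) (i : I) (y : X) : bool :=
  [forall x in b, K i y <= K i x].

(** Scarf's dominance: no element of [X] lies strictly above the minimum of [b] in all the orders at
    once. *)
Definition dominant (b : {set X}) : bool := [forall y, [exists i, low b i y]].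

Lemma lowP (b : {set X}) i y : reflect (forall x, x \in b -> K i y <= K i x) (low b i y).
Proof. exact: forall_inP. Qed.

Lemma dominantP (b : {set X}) : reflect (forall y, exists i, low b i y) (dominant b).
Proof. by apply: (iffP forallP) => h y; apply/existsP. Qed.

Lemma low_sub (a b : {set X}) i y : a \subset b -> low b i y -> low a i y.
Proof. by move=> /fintype.subsetP ab /lowP h; apply/lowP => x /ab /h. Qed.

Lemma dominant_sub (a b : {set X}) : a \subset b -> dominant b -> dominant a.
Proof.
by move=> ab /dominantP h; apply/dominantP => y; have [i] := h y;
  exists i; exact: low_sub ab _.
Qed.

Lemma low_inj (b : {set X}) i x y : x \in b -> y \in b -> low b i x -> low b i y -> x = y.
Proof.
move=> xb yb /lowP lx /lowP ly; apply: (@K_inj i); apply/eqP.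
by rewrite eqn_leq lx // ly.
Qed.

(* Only one element of the door is the lowest one for two indices [i], [j];
   exchanging it along the order [i], or along the order [j], gives the two
   rooms. *)
Lemma even_rooms (d : {set X}) (x0 : X) : #|d|.+1 = #|I| ->
    x0 \in d -> x0 \notin codom s ->
  ~~ odd #|[set y | (y \notin d) && dominant (y |: d)]|.
Proof.
move=> cd x0d x0s; set A := [set y | _].
case: (set_0Vmem A) => [->|[y0]]; first by rewrite cards0.
rewrite inE => /andP[_ /(dominant_sub (finset.subsetUr _ _)) domd {y0}].
pose f i : X := [arg min_(x < x0 in d) K i x].
have fP i : f i \in d /\ low d i (f i).
  rewrite /f; case: arg_minnP => // x xd h; split=> //.
  by apply/lowP => y /h.
have fd i := (fP i).1; have fl i := (fP i).2.
have fK i x : x \in d -> K i (f i) <= K i x by apply/lowP.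
have lowf i x : x \in d -> low d i x -> x = f i.
  by move=> xd xl; exact: low_inj xl (fl i).
have fsurj x : x \in d -> exists i, x = f i.
  by move=> xd; have /dominantP/(_ x)[i] := domd; exists i; exact: lowf.
have injC k : (forall x, x \in d -> exists2 l, l != k & x = f l) ->
    {in [set~ k] &, injective f}.
  move=> h; apply/imset_injP; suff -> : f @: [set~ k] = d.
    by rewrite cardsC1 -cd.
  apply/setP => x; apply/imsetP/idP => [[l _ ->]//|/h[l lk ->]].
  by exists l; rewrite // !inE.
have [i [j [nij fij]]] : exists i j, i != j /\ f i = f j.
  have [/existsP[i /existsP[j /andP[nij /eqP e]]]|h] :=
      boolP [exists i, [exists j, (i != j) && (f i == f j)]]; first by exists i, j.
  suff /card_in_imset : {in [set: I] &, injective f}.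
    have : #|f @: [set: I]| <= #|d|.
      by apply/subset_leq_card/fintype.subsetP => _ /imsetP[l _ ->].
    by move=> le e; move: le; rewrite e cardsT -cd ltnn.
  move=> a b _ _ e; apply/eqP; apply: contraT => nab; case/negP: h.
  by apply/existsP; exists a; apply/existsP; exists b; rewrite nab e eqxx.
have C_surj k : k = i \/ k = j -> forall x, x \in d -> exists2 l, l != k & x = f l.
  move=> kij x /fsurj[l ->]; have [->{l}|nlk] := eqVneq l k; last by exists l.
  by case: kij => ->; [exists j; rewrite // eq_sym|exists i].
pose M k := [set z | [forall (l | l != k), K l (f l) < K l z]].
have MP k z : reflect (forall l, l != k -> K l (f l) < K l z) (z \in M k).
  by rewrite inE; apply: (iffP forall_inP).
have sM k : s k \in M k.
  apply/MP => l nlk; apply: leq_ltn_trans (fK l _ x0d) _; exact: s_max.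
pose g k : X := [arg max_(z > s k in M k) K k z].
have [gM gmax] : (forall k, g k \in M k) /\
    (forall k z, z \in M k -> K k z <= K k (g k)).
  by split=> k; rewrite /g; case: arg_maxnP => // z zM h z' /h.
have gf k : K k (g k) <= K k (f k).
  have /dominantP/(_ (g k))[l] := domd; have [->|nlk] := eqVneq l k.
    by move/lowP/(_ _ (fd _)).
  by move/lowP/(_ _ (fd l)); rewrite leqNgt (MP _ _ (gM k)).
have nM k z : k = i \/ k = j -> z \in M k -> z \notin d.
  move=> kij /MP zM; apply/negP => /(C_surj _ kij)[l nlk zf].
  by have := zM l nlk; rewrite zf ltnn.
have gA k : k = i \/ k = j -> g k \in A.
  move=> kij; rewrite inE (nM k) //=; apply/dominantP => z.
  have [zM|] := boolP (z \in M k).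
    exists k; apply/lowP => x; rewrite in_setU1 => /predU1P[->|xd]; first exact: gmax.
    exact: leq_trans (gmax _ _ zM) (leq_trans (gf k) (fK _ _ xd)).
  rewrite inE negb_forall => /existsP[l]; rewrite negb_imply -leqNgt.
  move=> /andP[nlk zf]; exists l; apply/lowP => x.
  rewrite in_setU1 => /predU1P[->|xd]; apply: leq_trans zf _; last exact: fK.
  exact/ltnW/(MP _ _ (gM k)).
suff -> : A = [set g i; g j].
  rewrite cards2; suff -> : g i != g j by [].
  apply/eqP => e; have := MP _ _ (gM j) i nij.
  by rewrite -e ltnNge gf.
apply/setP => y; rewrite in_set2; apply/idP/orP; last first.
  by case=> /eqP->; apply: gA; [left|right].
rewrite inE => /andP[yd domy]; have ldy := finset.subsetUr [set y] d.
(* The new element is lowest in some order [k], so the elements of [d] must be lowest in the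
   remaining orders, one each. This forces [k] to be one of the two colliding indices. *)
have /dominantP/(_ y)[k /lowP ky] := domy.
have Ck x : x \in d -> exists2 l, l != k & x = f l /\ low (y |: d) l x.
  move=> xd; have /dominantP/(_ x)[l lx] := domy; exists l.
    apply: contraNneq yd => lk; have -> // : y = x.
    apply: (@K_inj k); apply/eqP; rewrite eqn_leq ky ?in_setU1 ?xd ?orbT //=.
    by move/lowP: lx; rewrite lk; apply; rewrite setU11.
  by split=> //; apply: lowf => //; exact: low_sub lx.
have injk : {in [set~ k] &, injective f}.
  by apply: injC => x /Ck[l nlk [-> _]]; exists l.
have kij : k = i \/ k = j.
  have [->|ki] := eqVneq k i; first by left.
  have [->|kj] := eqVneq k j; first by right.
  by case/eqP: nij; apply: injk; rewrite // !inE eq_sym.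
have yM : y \in M k.
  apply/MP => l nlk; have [l' nl'k [fl' /lowP ll']] := Ck _ (fd l).
  have e : l' = l by apply: injk; rewrite // !inE.
  rewrite e in ll'; rewrite ltn_neqAle ll' ?setU11 // andbT.
  by apply: contra_neq (memPn yd _ (fd l)) => /K_inj ->.
suff -> : y = g k by case: kij => ->; rewrite eqxx; [left|right].
have /dominantP/(_ (g k))[l /lowP lg] := domy.
have [lk|nlk] := eqVneq l k; last first.
  by have := lg _ (fintype.subsetP ldy _ (fd l)); rewrite leqNgt (MP _ _ (gM k)).
apply: (@K_inj k); apply/eqP; rewrite eqn_leq gmax //=.
by rewrite -{1 3}lk lg ?setU11.
Qed.

(** The set of all slacks is not dominant, because of [t0]. Hence this door can only be completed by
    an element that is not a slack, and dominance forces the greatest one in the order [i0]: there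
    is exactly one room. *)
Lemma odd_rooms_slack (i0 : I) (t0 : X) : t0 \notin codom s ->
  odd #|[set y | (y \notin s @: [set~ i0]) && dominant (y |: s @: [set~ i0])]|.
Proof.
move=> t0s; set d := s @: _.
pose g : X := [arg max_(z > t0 | z \notin codom s) K i0 z].
have [gs gmax] : g \notin codom s /\ (forall z, z \notin codom s -> K i0 z <= K i0 g).
  by rewrite /g; case: arg_maxnP => // z zs h; split=> // y /h.
have sd l : l != i0 -> s l \in d by move=> nl; rewrite imset_f // !inE.
suff -> : [set y | (y \notin d) && dominant (y |: d)] = [set g] by rewrite cards1.
apply/setP => y; rewrite finset.in_set1 inE; apply/andP/eqP => [[yd domy]|->{y}].
  have ldy := finset.subsetUr [set y] d.
  have ns : y \notin codom s.
    apply/negP => /codomP[i yi]; have ii0 : i = i0.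
      by apply/eqP; apply: contraNT yd; rewrite yi => /sd.
    have /dominantP/(_ t0)[l /lowP lt] := domy.
    have : K l t0 <= K l (s l).
      apply: lt; rewrite in_setU1; have [->|/sd ->] := eqVneq l i0.
        by rewrite yi ii0 eqxx.
      by rewrite orbT.
    move=> le; case/negP: t0s; apply/codomP; exists l.
    by apply: (@K_inj l); apply/eqP; rewrite eqn_leq le s_min.
  have /dominantP/(_ g)[l /lowP lg] := domy.
  have [li0|/sd sl] := eqVneq l i0.
    apply: (@K_inj i0); apply/eqP; rewrite eqn_leq gmax //=.
    by rewrite -li0 lg ?setU11.
  case/negP: gs; apply/codomP; exists l; apply: (@K_inj l); apply/eqP.
  by rewrite eqn_leq s_min lg // in_setU1 sl orbT.
split; first by apply: contra gs => /imsetP[l _ ->]; exact: codom_f.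
apply/dominantP => z; have [/codomP[l ->]|zs] := boolP (z \in codom s).
  by exists l; apply/lowP.
exists i0; apply/lowP => x; rewrite in_setU1 => /predU1P[->|]; first exact: gmax.
by case/imsetP => l; rewrite !inE => nl ->; apply/ltnW/s_max => //; rewrite eq_sym.
Qed.

(** The pairs of a room and a door in it that shows all colors but [i0] are counted in two ways.
    Door by door, the count is even except at the door of slacks, where it is odd; room by room, it
    is odd only if all colors occur. *)
Theorem dominant_rainbow (c : X -> I) (i0 : I) (t0 : X) :
    (forall i, c (s i) = i) -> t0 \notin codom s ->
  exists b : {set X}, dominant b /\ c @: b = [set: I].
Proof.
move=> cs t0s; have s_inj := can_inj cs.
pose rooms := [set b : {set X} | dominant b && (#|b| == #|I|)].
pose door (d : {set X}) := (#|d|.+1 == #|I|) && (c @: d == [set~ i0]).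
pose A := [set p : {set X} * X | [&& p.1 \in rooms, p.2 \in p.1 &
  c @: (p.1 :\ p.2) == [set~ i0]]].
pose B := [set p : {set X} * X | [&& door p.1, p.2 \notin p.1 &
  dominant (p.2 |: p.1)]].
have cAB : #|A| = #|B|.
  pose h (p : {set X} * X) := (p.1 :\ p.2, p.2).
  have hinj : {in A &, injective h}.
    move=> [b x] [b' x']; rewrite !inE /= => /and3P[_ xb _] /and3P[_ xb' _].
    case=> e ex; rewrite -ex in e xb' *.
    by rewrite -(finset.setD1K xb) e (finset.setD1K xb').
  rewrite -(card_in_imset hinj); congr #|pred_of_set _|; apply/setP => -[d y].
  rewrite !inE /=; apply/imsetP/and3P => [[[b x]]|].
    rewrite !inE /= => /and3P[/andP[db /eqP cb] xb cc] [-> ->].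
    rewrite /door cc !inE !eqxx finset.setD1K // -cb (cardsD1 x b) xb.
    by rewrite add1n eqxx.
  case=> /andP[cd cc] yd dd; exists (y |: d, y).
    by rewrite !inE /= dd cardsU1 yd eqxx setU1K // cd.
  by rewrite /h /= setU1K.
have sumA : #|A| = \sum_(b in rooms) #|[set x in b | c @: (b :\ x) == [set~ i0]]|.
  rewrite -sum1_card; under [RHS]eq_bigr do rewrite -sum1_card.
  rewrite pair_big_dep /=; apply: eq_bigl => -[b x].
  by rewrite !inE.
have sumB : #|B| = \sum_(d | door d) #|[set y | (y \notin d) && dominant (y |: d)]|.
  rewrite -sum1_card; under [RHS]eq_bigr do rewrite -sum1_card.
  by rewrite pair_big_dep /=; apply: eq_bigl => -[b x]; rewrite !inE.
have oddB : odd #|B|.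
  have Ed0 : c @: (s @: [set~ i0]) = [set~ i0].
    by rewrite -imset_comp (eq_imset _ cs) imset_id.
  have d0 : door (s @: [set~ i0]).
    have I_gt0 : 0 < #|I| by apply/card_gt0P; exists i0.
    by rewrite /door Ed0 card_imset // cardsC1 prednK // !eqxx.
  rewrite sumB (bigD1 _ d0) /= oddD (odd_rooms_slack i0 t0s).
  rewrite (big_morph odd oddD (erefl _)) big1 // => d /andP[/andP[cd cc] nd].
  apply/negbTE.
  (* As [s i] has color [i] and [i0] is missing, a door made only of slacks would be the slack
     door. *)
  have [x0 xd xs] : exists2 x, x \in d & x \notin codom s.
    apply/exists_inP; apply: contraNT nd; rewrite negb_exists_in => /forall_inP h.
    have /subset_leqif_cards[_ <-] : d \subset s @: [set~ i0].
      apply/fintype.subsetP => x xd; have := h x xd; rewrite negbK => /codomP[i xi].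
      rewrite xi imset_f //.
      by move/eqP: cc => <-; rewrite -(cs i) -xi imset_f.
    by move: cd; rewrite card_imset // cardsC1 => /eqP <-.
  by apply: even_rooms xd xs; exact/eqP.
have /negP : ~~ [forall (b | b \in rooms), c @: b != [set: I]].
  apply/negP => /forall_inP h; move: oddB; rewrite -cAB sumA.
  rewrite (big_morph odd oddD (erefl _)) big1 // => b bR.
  rewrite odd_card_missing_color; first exact/negbTE/h.
  by move: bR; rewrite inE => /andP[_ /eqP].
move/negP; rewrite negb_forall_in => /exists_inP[b bR]; rewrite negbK => /eqP cb.
by exists b; split=> //; move: bR; rewrite inE => /andP[].
Qed.

End Dominance.

(** * Scarf's lemma on the lattice points of a simplex *)

Definition grid_simplex (n p : nat) : finType :=
  {t : {ffun 'I_n.+1 -> 'I_p.+1} | \sum_i t i == p}.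

(* The order attached to [i] compares the [i]-th coordinates, with ties broken
   by an enumeration; the slack of index [i] is at the bottom of this order and
   above the grid for the others. *)
Definition grid_key n p (i : 'I_n.+1) (x : grid_simplex n p + 'I_n.+1) : nat :=
  match x with
  | inl t => (sval t i * #|grid_simplex n p| + enum_rank t).+1
  | inr j => if j == i then 0 else (p.+1 * #|grid_simplex n p|).+1 + j
  end.

Lemma grid_key_bound n p (i : 'I_n.+1) (t : grid_simplex n p) :
  grid_key i (inl t) < (p.+1 * #|grid_simplex n p|).+1.
Proof.
rewrite /= ltnS mulSn addnC; apply: leq_ltn_trans (leq_add (leqnn _) _) _.
- exact: (leq_mul (leq_ord (sval t i)) (leqnn _)).
- by rewrite ltn_add2r.
Qed.

Lemma grid_key_inj n p (i : 'I_n.+1) : injective (@grid_key n p i).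
Proof.
move=> [t|j] [t'|j'] /=.
- case=> e; congr inl; apply: enum_rank_inj; apply: val_inj => /=.
  have N0 : 0 < #|grid_simplex n p| by apply/card_gt0P; exists t.
  move: (congr1 (modn^~ #|grid_simplex n p|) e).
  by rewrite /= !modnMDl !modn_small.
- by have := grid_key_bound i t => /=; case: eqP => // _ h e; move: h; rewrite e ltnNge leq_addr.
- by have := grid_key_bound i t' => /=; case: eqP => // _ h e; move: h; rewrite -e ltnNge leq_addr.
- case: eqP => [->|_]; case: eqP => [->|_] //; try lia.
  by move=> /addnI /val_inj ->.
Qed.

Lemma grid_key_le n p (i : 'I_n.+1) (t t' : grid_simplex n p) :
  grid_key i (inl t) <= grid_key i (inl t') -> sval t i <= sval t' i.
Proof.
rewrite /= ltnS => le; rewrite leqNgt; apply/negP => lt.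
have := leq_trans (leq_addr _ _) le; apply/negP; rewrite -ltnNge.
apply: leq_trans (leq_mul lt (leqnn _)).
by rewrite mulSn addnC ltn_add2r.
Qed.

(** In a rainbow dominant set [b], let [C] index the absent slacks: their colors are realized by
    grid points. Dominance makes the minima over [b] of the coordinates in [C] sum to more than
    [p - n.+1], and since the coordinates of a point sum to [p], all grid points of [b] agree up to
    [n.+1]. *)
Lemma grid_rainbow n p (c : grid_simplex n p -> 'I_n.+1) :
  exists y : grid_simplex n p, forall i, sval y i <= n.+1 \/
    exists2 x, c x = i &
      forall j, sval x j <= sval y j + n.+1 /\ sval y j <= sval x j + n.+1.
Proof.
pose X : finType := (grid_simplex n p + 'I_n.+1)%type.
pose s (i : 'I_n.+1) : X := inr i.
have t0P : \sum_(i < n.+1) [ffun i : 'I_n.+1 => if i == ord0 then ord_max else ord0 : 'I_p.+1] i == p.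
  rewrite (bigD1 ord0) //= ffunE eqxx big1 ?addn0 // => i /negbTE ni.
  by rewrite ffunE ni.
pose grid_pt (t : {ffun 'I_n.+1 -> 'I_p.+1}) : \sum_i t i == p -> grid_simplex n p :=
  exist (fun t : {ffun 'I_n.+1 -> 'I_p.+1} => \sum_i t i == p) t.
pose t0 := grid_pt _ t0P.
have inls t : (inl t : X) \notin codom s by apply/codomP => -[].
pose c' (x : X) := match x with inl t => c t | inr i => i end.
have [||b [/dominantP dom cb]] := @dominant_rainbow X _ (@grid_key n p) s
   (@grid_key_inj n p) _ _ c' ord0 (inl t0) (fun i => erefl _) (inls t0).
- by move=> i x /=; rewrite eqxx.
- move=> i j [t|k] nij; last by move/negP; case; apply: codom_f.
  move=> _; apply: leq_trans (grid_key_bound i t) _.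
  by rewrite /= eq_sym (negbTE nij) leq_addr.
pose C : {set 'I_n.+1} := [set i | s i \notin b].
have Cc i : i \in C -> exists2 x, inl x \in b & c x = i.
  rewrite inE => ib; have /imsetP[[x|j]] : i \in c' @: b by rewrite cb inE.
    by move=> xb ->; exists x.
  by move=> jb /= ij; case/negP: ib; rewrite ij.
(* A slack of index [i] has key 0 in the order [i], below all grid points; so if it is in [b], no
   grid point can be low in that order. *)
have domC (y : grid_simplex n p) : exists2 i, i \in C & forall x, inl x \in b -> sval y i <= sval x i.
  have [i /lowP li] := dom (inl y); exists i.
    rewrite inE; apply/negP => /li; rewrite /= eqxx ltn0 //.
  by move=> x /li /grid_key_le.
have [i0 i0C _] := domC t0; have [x0 x0b _] := Cc _ i0C.
pose x_ i := [arg min_(x < x0 | inl x \in b) sval x i].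
have [xb xmin] : (forall i, inl (x_ i) \in b) /\
   (forall i (x : grid_simplex n p), inl x \in b -> sval (x_ i) i <= sval x i).
  by split=> i; rewrite /x_; case: arg_minnP.
pose m i : nat := sval (x_ i) i.
have sump (x : grid_simplex n p) : \sum_i (sval x i : nat) = p.
  by case: x => x /= /eqP.
have summ : p < \sum_(i in C) (m i).+1.
  rewrite ltnNge; apply/negP => le.
  (* This point exceeds every minimum [m i] with [i] in [C], against [domC]; the excess mass is put
     on [i0] to reach the total [p]. *)
  pose z (i : 'I_n.+1) := if i \in C then (m i).+1 + (i == i0) * (p - \sum_(i in C) (m i).+1) else 0.
  have sz : \sum_i z i = p.
    rewrite -big_mkcond /= big_split /= [X in _ + X](bigD1 i0) //= eqxx mul1n.
    by rewrite [X in _ + (_ + X)]big1 => [|i /andP[_ /negbTE ->]//]; rewrite addn0 subnKC.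
  have zp i : z i < p.+1 by rewrite ltnS -sz (bigD1 i) //= leq_addr.
  have yP : \sum_i [ffun i => inord (z i) : 'I_p.+1] i == p.
    by rewrite -[X in _ == X]sz; apply/eqP/eq_bigr => i _; rewrite ffunE inordK.
  have [i iC] := domC (grid_pt _ yP); move=> /(_ _ (xb i)).
  by rewrite /= ffunE inordK // /z iC -/(m i); lia.
have cC : #|C| <= n.+1 by rewrite -[X in _ <= X]card_ord max_card.
have summ' : p < \sum_(i in C) m i + n.+1.
  apply: leq_trans summ _; under eq_bigr do rewrite -addn1.
  by rewrite big_split /= sum1_card; apply: leq_add.
have below (x : grid_simplex n p) i : inl x \in b -> sval x i + \sum_(j in C | j != i) m j <= p.
  move=> x_b; rewrite -[leqRHS](sump x) [leqRHS](bigD1 i) //= leq_add2l.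
  rewrite [leqRHS](bigID (mem C)) /= [X in _ <= X + _](eq_bigl (fun j => (j \in C) && (j != i))); last first.
    by move=> j; rewrite andbC.
  by apply: leq_trans (leq_addr _ _); apply: leq_sum => j _; exact: xmin.
have inC (x : grid_simplex n p) i : inl x \in b -> i \in C -> m i <= sval x i <= m i + n.+1.
  move=> x_b iC; rewrite xmin //=; have := leq_ltn_trans (below x i x_b) summ'.
  by rewrite [X in _ < X + _](bigD1 i) //= addnAC ltn_add2r => /ltnW.
have outC (x : grid_simplex n p) i : inl x \in b -> i \notin C -> sval x i <= n.+1.
  move=> x_b iC; have := leq_ltn_trans (below x i x_b) summ'.
  rewrite (eq_bigl (mem C)); first by rewrite addnC ltn_add2l => /ltnW.
  move=> j /=; have [jC|//] := boolP (j \in C).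
  by apply: contraNneq iC => <-.
exists x0 => i; have [iC|iC] := boolP (i \in C); last by left; exact: outC.
right; have [x x_b cx] := Cc _ iC; exists x => // j.
have [jC|jC] := boolP (j \in C).
  by have := inC _ _ x_b jC; have := inC _ _ x0b jC; lia.
by have := outC _ _ x_b jC; have := outC _ _ x0b jC; lia.
Qed.

Local Open Scope classical_set_scope.
Local Open Scope ring_scope.

(** * Zeros of coercive maps *)

Lemma continuous_sum (R : realType) (U : topologicalType) (I : Type) (r : seq I)
    (P : pred I) (f : I -> U -> R) : (forall i, continuous (f i)) ->
  continuous (fun v => \sum_(i <- r | P i) f i v).
Proof. by move=> cf v; apply: cvg_big => [|i _]; [exact: add_continuous|exact: cf]. Qed.

Lemma arg_min_finite (R : realType) n (F : 'I_n.+1 -> R) :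
  exists i, forall k, F i <= F k.
Proof.
by case: (arg_minP F (isT : xpredT (ord0 : 'I_n.+1))) => i _ h; exists i => k; exact: h.
Qed.

Lemma simplex_closed (R : realType) n :
  closed [set v : 'rV[R]_n.+1 | (forall i, 0 <= v 0 i) /\ \sum_i v 0 i = 1].
Proof.
have cf i : continuous (fun v : 'rV[R]_n.+1 => v 0 i) by exact: coord_continuous.
have cs : continuous (fun v : 'rV[R]_n.+1 => \sum_i v 0 i).
  exact: continuous_sum.
rewrite [X in closed X](_ : _ =
  \bigcap_i ((fun v : 'rV[R]_n.+1 => v 0 i) @^-1` [set x | 0 <= x]) `&`
  (fun v => \sum_i v 0 i) @^-1` [set x | x = 1]).
  apply: closedI; last by apply: preimage_closed => [x _|]; [exact: cs|exact: closed_eq].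
  apply: closed_bigI => i _; apply: preimage_closed => [x _|]; first exact: cf.
  exact: closed_ge.
by apply/seteqP; split=> [v [h0 h1]|v [h0 h1]]; split=> // i; [move=> _|]; exact: h0.
Qed.

Lemma simplex_compact (R : realType) n :
  compact [set v : 'rV[R]_n.+1 | (forall i, 0 <= v 0 i) /\ \sum_i v 0 i = 1].
Proof.
apply: (subclosed_compact (@simplex_closed R n)
  (@rV_compact R n.+1 _ (fun i => @segment_compact R 0 1))).
move=> v [h0 h1] i /=; rewrite in_itv /= h0 -h1 (bigD1 i) //= lerDl.
exact: sumr_ge0.
Qed.

(** This is [grid_rainbow] on a grid of step [1 / p.+1]: an error of [n.+1] lattice steps tends to 0
    under refinement. *)
Lemma simplex_approx (R : realType) n (F : 'I_n.+1 -> 'rV[R]_n.+1 -> R) (p : nat) :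
  exists y : 'rV[R]_n.+1, ((forall i, 0 <= y 0 i) /\ \sum_i y 0 i = 1) /\
  forall i, y 0 i <= n.+1%:R / p.+1%:R \/ exists2 x : 'rV[R]_n.+1,
    forall j, `|y 0 j - x 0 j| <= n.+1%:R / p.+1%:R & forall k, F i x <= F k x.
Proof.
pose pt (t : grid_simplex n p.+1) : 'rV[R]_n.+1 := \row_i ((sval t i)%:R / p.+1%:R).
have p0 : 0 < p.+1%:R :> R by rewrite ltr0n.
pose c t := sval (cid (arg_min_finite (F^~ (pt t)))).
have cP t k : F (c t) (pt t) <= F k (pt t) by rewrite /c; case: cid.
have [y hy] := grid_rainbow c; exists (pt y); split.
  split=> [i|]; first by rewrite mxE divr_ge0.
  under eq_bigr do rewrite mxE; rewrite -mulr_suml -natr_sum.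
  by case: y {hy} => y /= /eqP ->; rewrite divff // gt_eqF.
move=> i; have [le|[x cx hx]] := hy i; [left|right].
  by rewrite mxE ler_pM2r ?invr_gt0 // ler_nat.
exists (pt x); last by rewrite -cx.
move=> j; have [h1 h2] := hx j; rewrite !mxE -mulrBl normrM [X in _ * X]ger0_norm ?invr_ge0 ?ler0n //.
rewrite ler_pM2r ?invr_gt0 // ler_norml.
by rewrite lerBrDr lerBlDr -natrD addrC lerBlDr -!natrD !ler_nat h1 addnC h2.
Qed.

(** The point [y] is a cluster point of those of [simplex_approx]. If [0 < y 0 i], the alternative
    of a small coordinate fails on fine grids, so [F i] is the smallest component at points
    arbitrarily close to [y], and continuity concludes. Equivalently, [y] minimizes over the simplex
    the linear form with coefficients [F i y]. *)
Lemma simplex_variational_inequality (R : realType) n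
    (F : 'I_n.+1 -> 'rV[R]_n.+1 -> R) : (forall i, continuous (F i)) ->
  exists y : 'rV[R]_n.+1, [/\ forall i, 0 <= y 0 i, \sum_i y 0 i = 1 &
    forall i k, 0 < y 0 i -> F i y <= F k y].
Proof.
move=> cF.
pose y_ p := sval (cid (simplex_approx F p)).
have yP p : ((forall i, 0 <= y_ p 0 i) /\ \sum_i y_ p 0 i = 1) /\
  forall i, y_ p 0 i <= n.+1%:R / p.+1%:R \/ exists2 x : 'rV[R]_n.+1,
    forall j, `|y_ p 0 j - x 0 j| <= n.+1%:R / p.+1%:R & forall k, F i x <= F k x.
  by rewrite /y_; case: cid.
have [|y [[y0 y1] cy]] := @simplex_compact R n (y_ @ \oo) _.
  by exists 0%N => // p _; case: (yP p).
exists y; split=> // i k yi; rewrite leNgt; apply/negP => lt.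
have : nbhs y ([set v : 'rV[R]_n.+1 | F k v < F i v] `&`
    [set v : 'rV[R]_n.+1 | y 0 i / 2 < v 0 i]).
  apply: filterI.
    have cB : (fun v => F i v - F k v) @ y --> F i y - F k y := cvgB (cF i y) (cF k y).
    have /cB : nbhs (F i y - F k y) [set x | 0 < x].
      by apply: open_nbhs_nbhs; split; [exact: open_gt|rewrite /= subr_gt0].
    by move=> h; apply: (@filterS _ (nbhs y) _ _ _ _ h) => v /=; rewrite subr_gt0.
  have /(@coord_continuous R 1 n.+1 0 i y) : nbhs (y 0 i) [set x | y 0 i / 2 < x].
    by apply: open_nbhs_nbhs; split; [exact: open_gt|rewrite /=; lra].
  by move=> h; apply: (@filterS _ (nbhs y) _ _ _ _ h).
move=> /nbhs_ballP[d /= d0 dU].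
have small (e : R) : 0 < e -> exists N : nat, forall p, (N <= p)%N -> n.+1%:R / p.+1%:R < e.
  move=> e0; exists (Num.trunc (n.+1%:R / e)) => p Np.
  rewrite ltr_pdivrMr ?ltr0n // mulrC -ltr_pdivrMr //.
  by apply: lt_le_trans (truncnS_gt _) _; rewrite ler_nat ltnS.
have [|N NP] := small (d / 2); first by rewrite divr_gt0.
have [|N' NP'] := small (y 0 i / 2); first by rewrite divr_gt0.
have [||z [[p Np <-] zy]] := cy [set y_ p | p in [set p | (N + N' <= p)%N]] (ball y (d / 2)).
- by exists (N + N')%N => // p Np; exists p.
- by apply: nbhsx_ballx; rewrite divr_gt0.
have NpN := leq_trans (leq_addr _ _) Np; have NpN' := leq_trans (leq_addl _ _) Np.
have [_ /(_ i)[le|[x xy xF]]] := yP p.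
  have : ball y d (y_ p) by apply: le_ball zy; lra.
  by move=> /dU[_ /=] h; have := le_lt_trans le (NP' _ NpN'); rewrite ltNge ltW.
have /dU[/=] : ball y d x; last by rewrite ltNge xF.
rewrite (splitr d); apply: ball_triangle zy _.
split=> [|a j]; first by rewrite divr_gt0.
by rewrite ord1 -ball_normE /=; apply: le_lt_trans (xy j) (NP _ NpN).
Qed.

(* The variational inequality is applied on a simplex centered at 0 and
   containing the ball of radius [rho]: comparing the solution with the center
   shows that it lies in this ball, hence in the interior of the simplex. *)
Lemma coercive_zero (R : realType) (J : finType) (G : J -> (J -> R) -> R) (rho : R) :
    0 < rho ->
    (forall (j : J) (U : topologicalType) (g : J -> U -> R),
      (forall k, continuous (g k)) -> continuous (fun u => G j (g^~ u))) ->
    (forall g, \sum_j g j * G j g <= 0 -> forall j, `|g j| < rho) ->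
  exists g, forall j, G j g = 0.
Proof.
move=> rho0 cG coer; set n := #|J|.
(* With this scale [L], the bound [rho] on [g y] becomes [a ^+ 2] on each deviation [y 0 k - a]. The
   [n] deviations then sum to at most [a * (1 - a)], less than [a], so the coordinate 0 stays
   positive as well. *)
pose a : R := n.+1%:R^-1; pose L := rho * n.+1%:R ^+ 2.
have a0 : 0 < a by rewrite invr_gt0 ltr0n.
have L0 : 0 < L by rewrite mulr_gt0 // exprn_gt0 // ltr0n.
have an : a *+ n = 1 - a.
  by apply/eqP; rewrite eq_sym subr_eq -mulrSr -mulr_natr mulVf // pnatr_eq0.
pose g (y : 'rV[R]_n.+1) (j : J) : R := L * (y 0 (lift ord0 (enum_rank j)) - a).
(* The extra coordinate gets the component 0. Once all coordinates of [y] are positive, all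
   components are equal, hence zero. *)
pose F (i : 'I_n.+1) y := if unlift ord0 i is Some k then G (enum_val k) (g y) else 0.
have cg j : continuous (fun y => g y j).
  move=> y; apply: (@continuousM R _ (fun=> L) (fun y : 'rV[R]_n.+1 => y 0 _ - a)).
    exact: cst_continuous.
  apply: (@continuousB R R _ (fun y : 'rV[R]_n.+1 => y 0 _) (fun=> a)).
    exact: coord_continuous.
  exact: cst_continuous.
have [|y [y0 y1 yF]] := @simplex_variational_inequality R n F.
  move=> i; rewrite /F; case: unlift => [k|]; last exact: cst_continuous.
  exact: (cG _ _ (fun j y => g y j)).
have F0 : F ord0 y = 0 by rewrite /F unlift_none.
have FS k : F (lift ord0 k) y = G (enum_val k) (g y) by rewrite /F liftK.
have sumJ (f : J -> R) : \sum_j f j = \sum_(k < n) f (enum_val k).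
  by rewrite (reindex _ (onW_bij _ (@enum_val_bij J))).
have yk k : \sum_i y 0 i * F i y <= F k y.
  rewrite -[leRHS]mul1r -y1 mulr_suml; apply: ler_sum => i _.
  have [->|nz] := eqVneq (y 0 i) 0; first by rewrite !mul0r.
  by rewrite ler_wpM2l // yF // lt_neqAle eq_sym nz y0.
have gG : \sum_j g y j * G j (g y) <= 0.
  rewrite sumJ.
  have -> : \sum_(k < n) g y (enum_val k) * G (enum_val k) (g y) =
      L * \sum_i (y 0 i - a) * F i y.
    rewrite big_ord_recl F0 mulr0 add0r mulr_sumr; apply: eq_bigr => k _.
    by rewrite /g enum_valK FS mulrA.
  rewrite pmulr_rle0 //; under eq_bigr do rewrite mulrBl.
  rewrite sumrB subr_le0.
  have : \sum_(k < n.+1) a * (\sum_i y 0 i * F i y) <= \sum_k a * F k y.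
    by apply: ler_sum => k _; rewrite ler_pM2l.
  by rewrite sumr_const card_ord -mulrnAl -mulr_natr mulVf ?pnatr_eq0 // mul1r.
have {}gG := coer _ gG.
have yg j : `|y 0 (lift ord0 (enum_rank j)) - a| < a ^+ 2.
  have := gG j; rewrite /g normrM gtr0_norm // mulrC -ltr_pdivlMr //.
  by rewrite invfM mulrA divff ?gt_eqF // mul1r -exprVn.
have yS k : `|y 0 (lift ord0 k) - a| < a ^+ 2.
  by have := yg (enum_val k); rewrite enum_valK.
have yS0 k : 0 < y 0 (lift ord0 k).
  have := yS k; rewrite ltr_norml => /andP[+ _].
  have : a ^+ 2 <= a by rewrite expr2 ger_pMr // invf_le1 ?ltr0n // ler1n.
  lra.
have y00 : 0 < y 0 ord0.
  have : \sum_(k < n) (y 0 (lift ord0 k) - a) <= \sum_(k < n) a ^+ 2.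
    by apply: ler_sum => k _; apply: le_trans (ler_norm _) (ltW (yS k)).
  rewrite sumrB !sumr_const card_ord.
  have := y1; rewrite big_ord_recl => e.
  have -> : a ^+ 2 *+ n = a * (1 - a) by rewrite expr2 -mulrnAr an.
  rewrite an; nra.
exists (g y) => j; apply/eqP; have := FS (enum_rank j); rewrite enum_rankK => <-.
by rewrite eq_le -{1}F0 yF //= -{1}F0 yF.
Qed.

(** * One step of the scheme *)

(** For [s >= 0], the bound [s <= expR s] reduces the claim to a quadratic polynomial in [s],
    bounded by completing the square. For [s < 0], the term [- u * s] is nonnegative and
    [- s * expR s <= 1]. *)
Lemma mass_term_ge (R : realType) (V u s : R) : 0 <= u ->
  - (expR (- V) + u ^+ 2 * expR V) <= (expR (s - V) - u) * s.
Proof.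
move=> u0; have eV : expR (- V) * expR V = 1 by rewrite -expRD addNr expR0.
have e0 := expR_gt0 (- V); have E0 := expR_gt0 V.
rewrite [s - V]addrC expRD.
move: eV e0 E0; set e := expR (- V); set E := expR V => eE e0 E0.
have [s0|s0] := leP 0 s.
  have h : s <= expR s by apply: le_trans (expR_ge1Dx s); rewrite lerDr.
  have h2 : e * s ^+ 2 <= e * expR s * s.
    by rewrite expr2 mulrA ler_wpM2r // ler_pM2l.
  have : 0 <= E * (e * s - u) ^+ 2 by rewrite mulr_ge0 ?sqr_ge0 // ltW.
  have -> : E * (e * s - u) ^+ 2 = (e * E) * (e * s ^+ 2) - (e * E) * (2 * s * u) + E * u ^+ 2 by ring.
  rewrite eE !mul1r => h3.
  have : 0 <= u * s by rewrite mulr_ge0.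
  have : 0 <= e * s ^+ 2 by rewrite mulr_ge0 ?sqr_ge0 // ltW.
  nra.
have h1 : - s * expR s <= 1.
  have h := expR_ge1Dx (- s); rewrite expRN in h.
  rewrite -ler_pdivlMr ?expR_gt0 // div1r; lra.
have h2 : e * (- s * expR s) <= e by rewrite ger_pMr.
have : 0 <= u * - s by rewrite mulr_ge0 // oppr_ge0 ltW.
have : 0 <= u ^+ 2 * E by rewrite mulr_ge0 ?sqr_ge0 // ltW.
nra.
Qed.

(** The exponential bounds [s] from above; only [- u * s] bounds it from below, which is where
    [0 < u] enters. In [D], the last quotient serves [s < 0] and the rest [s >= 0]. *)
Lemma mass_term_coercive (R : realType) (V u C : R) : 0 < u ->
  exists D, forall s, (expR (s - V) - u) * s <= C -> `|s| <= D.
Proof.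
move=> u0; have eV : expR (- V) * expR V = 1 by rewrite -expRD addNr expR0.
have e0 := expR_gt0 (- V); have E0 := expR_gt0 V.
exists (expR V * (u + `|C|) + 1 + (`|C| + expR (- V)) / u) => s.
rewrite [s - V]addrC expRD.
have := ler_norm C; have := normr_ge0 C; move: `|C| => C'.
move: eV e0 E0; set e := expR (- V); set E := expR V => eE e0 E0 C0 CC' hC.
have A0 : 0 <= (C' + e) / u by rewrite divr_ge0 ?addr_ge0 // ltW.
have B0 : 0 <= E * (u + C') by rewrite mulr_ge0 ?addr_ge0 // ltW.
have [s0|s0] := leP 0 s.
  rewrite ger0_norm //; suff : s <= E * (u + C') + 1 by lra.
  rewrite leNgt; apply/negP => lt.
  have h : s <= expR s by apply: le_trans (expR_ge1Dx s); rewrite lerDr.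
  have h2 : e * s * s <= e * expR s * s.
    by rewrite ler_wpM2r // ler_pM2l.
  have h3 : e * (E * (u + C') + 1) < e * s by rewrite ltr_pM2l.
  have e3 : e * (E * (u + C') + 1) = (e * E) * (u + C') + e by ring.
  rewrite e3 eE mul1r in h3.
  have : C' + e < e * s - u by lra.
  move=> h4; have : (C' + e) * s <= (e * s - u) * s by rewrite ler_wpM2r // ltW.
  have : 1 < s by lra.
  nra.
rewrite ltr0_norm //; suff : - s <= (C' + e) / u by lra.
rewrite ler_pdivlMr //.
have h1 : - s * expR s <= 1.
  have h := expR_ge1Dx (- s); rewrite expRN in h.
  rewrite -ler_pdivlMr ?expR_gt0 // div1r; lra.
have h2 : e * (- s * expR s) <= e by rewrite ger_pMr.
nra.
Qed.

(** It serves to reduce the system tested by all [psi] to one scalar equation per unknown, as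
    [coercive_zero] requires. *)
Lemma linear_form_expand (R : realType) (X : finType) (L : (X -> R) -> R) :
    (forall a f g, L (fun x => a * f x + g x) = a * L f + L g) ->
  forall psi, L psi = \sum_x psi x * L (fun y => (y == x)%:R).
Proof.
move=> Llin psi.
have L0 : L (fun=> 0) = 0.
  have e : L (fun=> -1 * 0 + 0) = 0 by rewrite Llin mulN1r addNr.
  by rewrite mulr0 addr0 in e.
have Lsum (s : seq X) : L (fun y => \sum_(x <- s) psi x * (y == x)%:R) =
    \sum_(x <- s) psi x * L (fun y => (y == x)%:R).
  elim: s => [|x s IH].
    by rewrite big_nil; apply: etrans L0; congr L; apply/funext => y; rewrite big_nil.
  by rewrite big_cons -IH -Llin; congr L; apply/funext => y; rewrite big_cons.
rewrite -Lsum; congr L; apply/funext => y.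
rewrite (bigD1 y) //= eqxx mulr1 big1 ?addr0 // => x nxy.
by rewrite eq_sym (negbTE nxy) mulr0.
Qed.

(** This is the tangent inequality at [b], where the derivative of the entropy is [ln b]. It comes
    from [ln x <= x - 1] at [x = b / a]. *)
Lemma entropyH_convex (R : realType) (a b : R) : 0 <= a -> 0 < b ->
  entropyH b - entropyH a <= (b - a) * ln b.
Proof.
move=> a0 b0; rewrite /entropyH; have [->|na] := eqVneq a 0; first by rewrite mul0r; nra.
have {}a0 : 0 < a by rewrite lt_neqAle eq_sym na.
have : ln (b / a) <= b / a - 1.
  have ba : 0 < b / a by rewrite divr_gt0.
  by have := @le_ln1Dx R (b / a - 1); rewrite [1 + _]addrC subrK; apply; lra.
rewrite ln_div ?posrE // => h.
have : a * (ln b - ln a) <= a * (b / a - 1) by rewrite ler_pM2l.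
have -> : a * (b / a - 1) = b - a by field.
lra.
Qed.

Lemma abs_le_of_sqr (R : realType) (x q : R) : x ^+ 2 <= q -> `|x| <= 1 + q.
Proof.
move=> h; have : 0 <= x ^+ 2 by exact: sqr_ge0.
have := sqr_ge0 (x - 1); have := sqr_ge0 (x + 1).
rewrite ler_norml => h1 h2 h3; apply/andP; split; nra.
Qed.

Section Solvability.
Context {R : realType} (m : ddfv_data R).
Context (Lambda : plane R -> 'M[R]_2) (V : plane R -> R) (kappa beta dt : R).
Context (u : unknown m -> R).

(* The unknowns that carry mass: the degenerate boundary cells carry none. *)
Definition bulk : finType := (pcell m + vertex m)%type.

Definition unk (x : bulk) : unknown m :=
  match x with inl K => inl (inl K) | inr v => inr v end.

Definition mass (x : bulk) : R :=
  match x with inl K => m_cell K | inr v => m_dual v end.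

Lemma dprodE (v w : unknown m -> R) :
  dprod v w = 2^-1 * \sum_(x : bulk) mass x * w (unk x) * v (unk x).
Proof. by rewrite /dprod big_sumType. Qed.

Hypothesis mass_gt0 : forall x, 0 < mass x.
Hypothesis m_cap_ge0 : forall (K : pcell m) (v : vertex m), 0 <= m_cap K v.
(** Connectedness of the overlap graph, phrased for its later use with [P] the boundedness of [g] at
    an unknown. *)
Hypothesis overlap_connected : forall P : bulk -> Prop,
  (forall K v, 0 < m_cap K v -> P (inl K) <-> P (inr v)) ->
  forall x y, P x -> P y.
Hypothesis AD_coercive : forall e : edge m, exists2 c, 0 < c &
  forall w : plane R, c * dot w w <= dot w (mxapp (AD Lambda e) w).
Hypothesis mesh_size_gt0 : 0 < mesh_size m.
Hypothesis kappa_gt0 : 0 < kappa.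
Hypothesis dt_gt0 : 0 < dt.
Hypothesis u_ge0 : forall x, 0 <= u (unk x).
Hypothesis u_neq0 : exists x, 0 < u (unk x).

Definition density (g : unknown m -> R) : unknown m -> R :=
  fun x => expR (g x - V_disc V x).

Definition weak_form (g psi : unknown m -> R) : R :=
  dprod (fun x => (density g x - u x) / dt) psi + TD Lambda (density g) g psi +
  kappa * dprod (penalization beta g) psi.

Lemma potential_density g : potential V (density g) = g.
Proof. by apply/funext => x; rewrite /potential /density expRK subrK. Qed.

Lemma dprod_linear v a (f h : unknown m -> R) :
  dprod v (fun x => a * f x + h x) = a * dprod v f + dprod v h.
Proof.
rewrite !dprodE mulrCA -mulrDr; congr (_ * _); rewrite mulr_sumr -big_split /=.
by apply: eq_bigr => x _; ring.
Qed.

Lemma TD_linear w g a (f h : unknown m -> R) :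
  TD Lambda w g (fun x => a * f x + h x) = a * TD Lambda w g f + TD Lambda w g h.
Proof.
rewrite /TD mulr_sumr -big_split /=; apply: eq_bigr => e _.
by rewrite /dot /mxapp /deltaD /=; ring.
Qed.

Lemma weak_form_expand g psi :
  weak_form g psi = \sum_x psi x * weak_form g (fun y => (y == x)%:R).
Proof.
apply: linear_form_expand => a f h.
by rewrite /weak_form !dprod_linear TD_linear; ring.
Qed.

Lemma weak_form_continuous (U : topologicalType) (g : unknown m -> U -> R) psi :
  (forall x, continuous (g x)) -> continuous (fun v => weak_form (g^~ v) psi).
Proof.
move=> cg.
have cst c : continuous (fun _ : U => c : R) by exact: cst_continuous.
have cB (f h : U -> R) : continuous f -> continuous h -> continuous (fun v => f v - h v).
  by move=> cf ch v; apply: cvgB; [exact: cf|exact: ch].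
have cD (f h : U -> R) : continuous f -> continuous h -> continuous (fun v => f v + h v).
  by move=> cf ch v; apply: cvgD; [exact: cf|exact: ch].
have cM (f h : U -> R) : continuous f -> continuous h -> continuous (fun v => f v * h v).
  by move=> cf ch v; apply: cvgM; [exact: cf|exact: ch].
have cE x : continuous (fun v => density (g^~ v) x).
  move=> v; apply: (@continuous_comp _ _ _ (fun v => g x v - V_disc V x) expR).
    exact: (cB _ _ (cg x) (cst _)).
  exact: continuous_expR.
have cdprod (f : unknown m -> U -> R) : (forall x, continuous (f (unk x))) ->
    continuous (fun v => dprod (f^~ v) psi).
  move=> cf; under eq_fun do rewrite dprodE.
  by apply: (cM) => //; apply: continuous_sum => x; apply: (cM).
rewrite /weak_form; apply: (cD); first apply: (cD).
- by apply: (cdprod (fun x v => (density (g^~ v) x - u x) / dt)) => x; apply: (cM) => //; apply: (cB).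
- apply: continuous_sum => e; rewrite /rD /dot /=.
  by apply: (cM); [apply: (cM) => //; do !apply: (cD)|apply: (cD); apply: (cM) => //; apply: (cB)].
- apply: (cM) => //; apply: (cdprod (fun x v => penalization beta (g^~ v) x)) => -[K|v] /=.
    by apply: (cM) => //; apply: continuous_sum => v; apply: (cM) => //; apply: (cB).
  by apply: (cM) => //; apply: continuous_sum => K; apply: (cM) => //; apply: (cB).
Qed.

(** The masses cancel, and each overlap is met once from its primal cell and once from its dual
    cell; the two contributions add up to a square. *)
Lemma dprod_penalization (g : unknown m -> R) : dprod (penalization beta g) g =
  2^-1 * (mesh_size m `^ beta)^-1 *
    \sum_K \sum_v m_cap K v * (g (inl (inl K)) - g (inr v)) ^+ 2.
Proof.
have : mesh_size m `^ beta != 0 by rewrite gt_eqF // powR_gt0.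
rewrite /dprod /penalization; move: (_ `^ _) => s s0.
have aux a b S : 0 < a -> a * b * ((a * s)^-1 * S) = s^-1 * (S * b).
  by move=> a0; field; rewrite s0 gt_eqF.
under eq_bigr do rewrite (aux _ _ _ (mass_gt0 (inl _))) mulr_suml.
under [X in _ + X]eq_bigr do rewrite (aux _ _ _ (mass_gt0 (inr _))) mulr_suml.
rewrite -!mulr_sumr [X in _ + _ * X]exchange_big /= -mulrDr mulrA -big_split /=.
congr (_ * _); apply: eq_bigr => K _; rewrite -big_split /=.
by apply: eq_bigr => v _; ring.
Qed.

Lemma rD_gt0 g (e : edge m) : 0 < rD (density g) e.
Proof. by rewrite mulr_gt0 ?invr_gt0 // !addr_gt0 ?expR_gt0. Qed.

Lemma TD_term_ge0 g (e : edge m) :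
  0 <= rD (density g) e * dot (deltaD g e) (mxapp (AD Lambda e) (deltaD g e)).
Proof.
rewrite pmulr_rge0 ?rD_gt0 //; have [c c0 /(_ (deltaD g e))] := AD_coercive e.
by apply: le_trans; rewrite pmulr_rge0 // /dot addr_ge0 // -expr2 sqr_ge0.
Qed.

Lemma TD_ge0 g : 0 <= TD Lambda (density g) g g.
Proof. by apply: sumr_ge0 => e _; exact: TD_term_ge0. Qed.

(** Of one diamond, only the difference between its two primal values is kept: for a boundary edge,
    this controls the boundary unknown. *)
Lemma TD_ge_edge g (e : edge m) c : 0 < c ->
    (forall w : plane R, c * dot w w <= dot w (mxapp (AD Lambda e) w)) ->
  rD (density g) e * (c * (deltaD g e).1 ^+ 2) <= TD Lambda (density g) g g.
Proof.
move=> c0 hc; rewrite /TD (bigD1 e) //= -[leLHS]addr0 lerD //.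
  rewrite ler_pM2l ?rD_gt0 //; apply: le_trans (hc _).
  by rewrite ler_pM2l // /dot lerDl -expr2 sqr_ge0.
by apply: sumr_ge0 => f _; exact: TD_term_ge0.
Qed.

Lemma penalization_ge (g : unknown m -> R) K v :
  2^-1 * (mesh_size m `^ beta)^-1 *
    (m_cap K v * (g (inl (inl K)) - g (inr v)) ^+ 2) <=
  dprod (penalization beta g) g.
Proof.
have s0 : 0 < mesh_size m `^ beta by rewrite powR_gt0.
rewrite dprod_penalization ler_pM2l; last by rewrite mulr_gt0 ?invr_gt0.
have t0 K' v' : 0 <= m_cap K' v' * (g (inl (inl K')) - g (inr v')) ^+ 2.
  by rewrite mulr_ge0 ?sqr_ge0.
rewrite (bigD1 K) //= (bigD1 v) //= -addrA lerDl.
by apply: addr_ge0; apply: sumr_ge0 => // K' _; exact: sumr_ge0.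
Qed.

Lemma penalization_ge0 (g : unknown m -> R) : 0 <= dprod (penalization beta g) g.
Proof.
have s0 : 0 < mesh_size m `^ beta by rewrite powR_gt0.
rewrite dprod_penalization; apply: mulr_ge0; first by rewrite mulr_ge0 ?invr_ge0 // ltW.
by apply: sumr_ge0 => K _; apply: sumr_ge0 => v _; rewrite mulr_ge0 ?sqr_ge0.
Qed.

(** The lower bounds of [mass_term_ge] added up, with the factor 1/2 of [dprod]: added to the mass
    form, it makes every term nonnegative, whatever [g] is. *)
Definition mass_bound : R := (2 * dt)^-1 * \sum_x mass x *
  (expR (- V_disc V (unk x)) + u (unk x) ^+ 2 * expR (V_disc V (unk x))).

Lemma mass_form_sum g : mass_bound + dprod (fun y => (density g y - u y) / dt) g =
  \sum_x (2 * dt)^-1 * (mass x *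
    (expR (- V_disc V (unk x)) + u (unk x) ^+ 2 * expR (V_disc V (unk x)) +
     (density g (unk x) - u (unk x)) * g (unk x))).
Proof.
rewrite dprodE /mass_bound !mulr_sumr -big_split /=; apply: eq_bigr => x _.
by field; rewrite gt_eqF.
Qed.

Lemma mass_form_term_ge0 g x : 0 <= (2 * dt)^-1 * (mass x *
    (expR (- V_disc V (unk x)) + u (unk x) ^+ 2 * expR (V_disc V (unk x)) +
     (density g (unk x) - u (unk x)) * g (unk x))).
Proof.
rewrite pmulr_rge0 ?invr_gt0 ?mulr_gt0 // pmulr_rge0 //.
by have := mass_term_ge (V_disc V (unk x)) (g (unk x)) (u_ge0 x); rewrite /density; lra.
Qed.

Lemma mass_form_ge0 g : 0 <= mass_bound + dprod (fun y => (density g y - u y) / dt) g.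
Proof. by rewrite mass_form_sum; apply: sumr_ge0 => x _; exact: mass_form_term_ge0. Qed.

Lemma mass_form_ge g (x : bulk) :
  (2 * dt)^-1 * (mass x * ((density g (unk x) - u (unk x)) * g (unk x))) <=
  mass_bound + dprod (fun y => (density g y - u y) / dt) g.
Proof.
rewrite mass_form_sum (bigD1 x) //= -[leLHS]addr0 lerD //.
  rewrite ler_pM2l ?invr_gt0 ?mulr_gt0 // ler_pM2l // lerDr.
  by rewrite addr_ge0 ?mulr_ge0 ?sqr_ge0 ?expR_ge0.
by apply: sumr_ge0 => y _; exact: mass_form_term_ge0.
Qed.

Lemma weak_form_coercive : exists2 rho, 0 < rho &
  forall g, weak_form g g <= 0 -> forall x, `|g x| < rho.
Proof.
(* The bound is uniform in [g]: [D] is chosen before [g]. *)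
pose bounded x := exists D, forall g, weak_form g g <= 0 -> `|g x| <= D.
have bounded_step x y q : bounded x ->
    (forall g, weak_form g g <= 0 -> (g x - g y) ^+ 2 <= q) -> bounded y.
  move=> [D hD] hq; exists (D + (1 + q)) => g Sg.
  have := abs_le_of_sqr (hq g Sg); have := hD g Sg.
  move=> h1 h2; rewrite -[g y](subKr (g x)).
  exact: le_trans (ler_normB _ _) (lerD h1 h2).
have split_form g : weak_form g g <= 0 ->
    [/\ dprod (fun x => (density g x - u x) / dt) g <= 0,
        TD Lambda (density g) g g <= mass_bound &
        kappa * dprod (penalization beta g) g <= mass_bound].
  have T0 := TD_ge0 g; have P0 : 0 <= kappa * dprod (penalization beta g) g.
    by rewrite mulr_ge0 ?penalization_ge0 // ltW.
  have M0 := mass_form_ge0 g.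
  by rewrite /weak_form => le; split; lra.
have [x0 ux0] := u_neq0.
have bounded_bulk x : bounded (unk x).
  apply: (@overlap_connected (fun x => bounded (unk x)) _ x0 x).
    move=> K v cap0; set s := 2^-1 * (mesh_size m `^ beta)^-1.
    have s0 : 0 < s by rewrite mulr_gt0 ?invr_gt0 // powR_gt0.
    have hq g : weak_form g g <= 0 ->
        (g (unk (inl K)) - g (unk (inr v))) ^+ 2 <= mass_bound / (kappa * s * m_cap K v).
      case/split_form => _ _ hP.
      rewrite ler_pdivlMr; last exact: mulr_gt0 (mulr_gt0 kappa_gt0 s0) cap0.
      apply: le_trans hP; have := penalization_ge g K v; rewrite -/s => h.
      rewrite [leLHS](_ : _ = kappa * (s * (m_cap K v * (g (unk (inl K)) - g (unk (inr v))) ^+ 2))).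
        by rewrite ler_pM2l.
      by ring.
    split=> bx; apply: bounded_step bx _ => g Sg; first exact: hq.
    by rewrite -sqrrN opprB; exact: hq.
  have [D hD] := mass_term_coercive (V_disc V (unk x0)) (mass_bound * (2 * dt) / mass x0) ux0.
  exists D => g Sg; apply: hD.
  have [hM _ _] := split_form g Sg.
  have h : (2 * dt)^-1 * (mass x0 * ((density g (unk x0) - u (unk x0)) * g (unk x0))) <=
      mass_bound by have := mass_form_ge g x0; lra.
  by rewrite ler_pdivlMr // -ler_pdivrMr ?mulr_gt0 // mulrC [_ * mass x0]mulrC.
have bounded_all x : bounded x.
  case: x => [[K|b]|v]; [exact: (bounded_bulk (inl K))| |exact: (bounded_bulk (inr v))].
  have bK := bounded_bulk (inl (eK (inr b : edge m))); have [D hD] := bK.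
  have [c c0 hc] := AD_coercive (inr b).
  pose K := unk (inl (eK (inr b : edge m))).
  (* A lower bound for [rD] in this diamond that uses only the density of the adjacent cell, since
     the boundary value is not yet controlled. *)
  pose w := 4^-1 * expR (- D - V_disc V K).
  have w0 : 0 < w by rewrite mulr_gt0 ?invr_gt0 ?expR_gt0.
  apply: (bounded_step _ _ (mass_bound / (w * c))) bK _ => g Sg.
  have [_ hT _] := split_form g Sg.
  rewrite ler_pdivlMr; last exact: mulr_gt0 w0 c0.
  apply: le_trans hT; apply: le_trans (TD_ge_edge g c0 hc).
  rewrite mulrC -mulrA /=.
  rewrite ler_wpM2r //; first by rewrite mulr_ge0 ?sqr_ge0 // ltW.
  rewrite /rD ler_pM2l ?invr_gt0 // -!addrA -[leLHS]addr0 lerD //.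
    rewrite ler_expR lerD2r; have := hD g Sg; rewrite ler_norml => /andP[+ _].
    by rewrite lerNl.
  by rewrite !addr_ge0 // expR_ge0.
have [D hD] := choice bounded_all.
exists (1 + \sum_x `|D x|); first by rewrite ltr_pwDl // sumr_ge0.
move=> g Sg x; apply: le_lt_trans (hD x g Sg) _.
apply: le_lt_trans (ler_norm _) _.
by rewrite (bigD1 x) //= addrCA ltrDl ltr_pwDl // sumr_ge0.
Qed.

Lemma scheme_step_ex : exists w, scheme_step Lambda V kappa beta dt u w.
Proof.
have [rho rho0 coer] := weak_form_coercive.
have [|g|g hg] := @coercive_zero R (unknown m)
    (fun x g => weak_form g (fun y => (y == x)%:R)) rho rho0.
- by move=> x U g; exact: weak_form_continuous.
- by rewrite -weak_form_expand; exact: coer.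
exists (density g); split=> [x|psi]; first exact: expR_gt0.
rewrite potential_density -/(weak_form g psi) weak_form_expand big1 // => x _.
by rewrite hg mulr0.
Qed.

(** Every solution satisfies the estimate, not only the constructed one: for the test function
    [potential V w], the term [TD] is the dissipation itself and the penalization has a sign. *)
Lemma scheme_step_entropy w : scheme_step Lambda V kappa beta dt u w ->
  entropy_estimate Lambda V dt u w.
Proof.
move=> [w0 /(_ (potential V w))]; rewrite /entropy_estimate /dissipation.
set g := potential V w.
have : (energy V w - energy V u) / dt <= dprod (fun x => (w x - u x) / dt) g.
  rewrite /energy !dprodE -!mulrDr -mulrBr -mulrA ler_pM2l ?invr_gt0 //.
  rewrite -!big_split -sumrB mulr_suml /=; apply: ler_sum => x _.
  rewrite mulrC ler_pdivrMl //.
  have -> : dt * (mass x * g (unk x) * ((w (unk x) - u (unk x)) / dt)) =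
     mass x * ((w (unk x) - u (unk x)) * (ln (w (unk x)) + V_disc V (unk x))).
    by rewrite /g /potential; field; rewrite gt_eqF.
  have := entropyH_convex (u_ge0 x) (w0 (unk x)) => h.
  have : mass x * (entropyH (w (unk x)) - entropyH (u (unk x))) <=
     mass x * ((w (unk x) - u (unk x)) * ln (w (unk x))) by rewrite ler_pM2l.
  lra.
have := penalization_ge0 g.
move=> P0; have : 0 <= kappa * dprod (penalization beta g) g by rewrite mulr_ge0 // ltW.
lra.
Qed.

End Solvability.

(** * Areas and integrals in the plane *)

Import HBNNSimple.

(** The integral of a nonnegative function is a supremum over the simple functions below it. Such a
    function below [f] can be set to 0 on [N] without changing its integral, and it is then below
    [g]; no measurability of [f] or [g] enters. *)
Lemma le_integral_off_negligible d (T : measurableType d) (R : realType)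
    (mu : {measure set T -> \bar R}) (N : set T) (f g : T -> \bar R) :
    measurable N -> mu N = 0%E ->
    (forall x, 0 <= f x)%E -> (forall x, 0 <= g x)%E ->
    (forall x, ~ N x -> f x <= g x)%E ->
  (\int[mu]_x f x <= \int[mu]_x g x)%E.
Proof.
move=> mN N0 f0 g0 fg; rewrite ge0_integralTE // ge0_integralTE //.
apply: ge_ereal_sup => _ [h /= hf <-].
have mNC : measurable (~` N) by exact: measurableC.
have hE : sintegral mu h = sintegral mu (proj_nnsfun h mNC).
  transitivity (\int[mu]_(x in ~` N) (h x)%:E)%E.
    transitivity (\int[mu]_x (h x)%:E)%E; first by rewrite integral_nnsfun // patch_setT.
    rewrite -setTD; apply: ge0_negligible_integral => //.
      exact/measurable_EFinP.
    by move=> x _; rewrite lee_fin.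
  by rewrite integral_nnsfun // mrestrict.
rewrite hE; apply: ereal_sup_ubound; exists (proj_nnsfun h mNC) => //.
move=> x; rewrite -mrestrict patchE; case: ifPn => [|_]; last exact: g0.
by rewrite inE => /fg; apply: le_trans.
Qed.

(** The measure lives on the product sigma-algebra, so an open set is written as a countable union
    of products of balls with rational centers and radii [1 / k.+1]. *)
Lemma open_measurable_plane (R : realType) (U : set (plane R)) : open U ->
  measurable (U : set (measurableTypeR R * measurableTypeR R)).
Proof.
move=> oU.
pose B (t : rat * rat * nat) : set (measurableTypeR R * measurableTypeR R) :=
  ball (ratr t.1.1 : R) (t.2.+1%:R^-1) `*` ball (ratr t.1.2 : R) (t.2.+1%:R^-1).
pose F t := if `[< B t `<=` U >] then B t else set0.
rewrite [X in measurable X](_ : _ = \bigcup_t F t).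
  apply: countable_bigcupT_measurable => [|t]; first exact: countableP.
  rewrite /F; case: ifP => // _; apply: measurableX; exact: measurable_ball.
apply/seteqP; split=> [p Up|p [t _]]; last first.
  by rewrite /F; case: asboolP => // h /h.
have /nbhs_ballP[e /= e0 eU] : nbhs p U by apply: open_nbhs_nbhs.
have [k hk] : exists k : nat, 2 * k.+1%:R^-1 < e.
  exists (Num.trunc (2 / e)); rewrite ltr_pdivrMr ?ltr0n // mulrC -ltr_pdivrMr //.
  exact: truncnS_gt.
have k0 : 0 < k.+1%:R^-1 :> R by rewrite invr_gt0.
have approx (x r : R) : 0 < r -> exists q : rat, ball (ratr q : R) r x.
  move=> r0; have /rat_in_itvoo[q] : x - r < x + r by lra.
  rewrite in_itv /= => /andP[h1 h2]; exists q.
  by rewrite -ball_normE /= ltr_norml; apply/andP; split; lra.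
have [q1 h1] := approx p.1 _ k0; have [q2 h2] := approx p.2 _ k0.
exists (q1, q2, k) => //; rewrite /F; case: asboolP => [_|]; first by split.
case=> z [/= z1 z2]; apply: eU.
have tri (x y q : R) : ball q k.+1%:R^-1 x -> ball q k.+1%:R^-1 y -> ball x e y.
  move=> /ball_sym hx hy; apply: (le_ball (ltW hk)).
  by rewrite mulr2n mulrDl mul1r; apply: ball_triangle hx hy.
by split; [exact: tri h1 z1|exact: tri h2 z2].
Qed.

Lemma ge0_integral_ae_eq d (T : measurableType d) (R : realType)
    (mu : {measure set T -> \bar R}) (f g : T -> \bar R) :
    (forall x, 0 <= f x)%E -> (forall x, 0 <= g x)%E ->
    {ae mu, forall x, f x = g x} ->
  (\int[mu]_x f x = \int[mu]_x g x)%E.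
Proof.
move=> f0 g0 [N [mN N0 fgN]].
have off x : ~ N x -> f x = g x by move=> nN; apply: contrapT => nfg; exact/nN/fgN.
by apply/eqP; rewrite eq_le; apply/andP; split;
  apply: (@le_integral_off_negligible _ _ _ _ N) => // x /off ->.
Qed.

(* Unlike [ae_eq_integral], no measurability is required of [f] and [g]: the
   integrand may be measurable for the completed sigma-algebra only. *)
Lemma integral_ae_eq d (T : measurableType d) (R : realType)
    (mu : {measure set T -> \bar R}) (D : set T) (f g : T -> \bar R) :
    {ae mu, forall x, D x -> f x = g x} ->
  (\int[mu]_(x in D) f x = \int[mu]_(x in D) g x)%E.
Proof.
move=> fg; rewrite -[LHS]/(_ - _)%E -[RHS]/(_ - _)%E.
have fgD : {ae mu, forall x, (f \_ D) x = (g \_ D) x}.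
  by apply: filterS fg => x h; rewrite !patchE; case: ifPn => // /set_mem/h.
rewrite -!(ge0_integralTE mu) //; congr (_ - _)%E; apply: ge0_integral_ae_eq => //;
  by apply: filterS fgD => x h; rewrite ?funeposE ?funenegE h.
Qed.

Lemma leb2_rectangle (R : realType) (A B : set (measurableTypeR R)) :
  measurable A -> measurable B ->
  leb2 R (A `*` B) = (lebesgue_measure A * lebesgue_measure B)%E.
Proof. exact: product_measure1E. Qed.

Lemma leb2_gt0 (R : realType) (U : set (plane R)) : open U -> U !=set0 ->
  (0 < leb2 R U)%E.
Proof.
move=> oU [p Up]; have /nbhs_ballP[e /= e0 eU] : nbhs p U by apply: open_nbhs_nbhs.
have mB (x : R) : measurable (ball x e : set (measurableTypeR R)) by exact: measurable_ball.
apply: (@lt_le_trans _ _ (leb2 R (ball p.1 e `*` ball p.2 e))).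
  rewrite leb2_rectangle // !lebesgue_measure_ball ?ltW //.
  by rewrite -EFinM lte_fin mulr_gt0 // mulrn_wgt0.
apply: le_measure; rewrite ?inE.
- exact: measurableX.
- exact: open_measurable_plane.
- by move=> z [z1 z2]; apply: eU.
Qed.

Lemma bounded_plane (R : realType) (U : set (plane R)) : bounded_set U ->
  exists M, forall z, U z -> `|z.1| <= M /\ `|z.2| <= M.
Proof.
move=> [M [_ /(_ (M + 1))]]; rewrite ltrDl ltr01 => /(_ isT) UM; exists (M + 1).
by move=> z /UM /=; rewrite prod_normE ge_max => /andP.
Qed.

Lemma leb2_lty (R : realType) (U : set (plane R)) : open U -> bounded_set U ->
  (leb2 R U < +oo)%E.
Proof.
move=> oU /bounded_plane[M UM].
have mI : measurable (`[- M, M]%classic : set (measurableTypeR R)).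
  exact: measurable_itv.
apply: (@le_lt_trans _ _ (leb2 R (`[- M, M]%classic `*` `[- M, M]%classic))).
  apply: le_measure; rewrite ?inE.
  - exact: open_measurable_plane.
  - exact: measurableX.
  - move=> z /UM[z1 z2].
    by split; rewrite /= in_itv /= -ler_norml.
rewrite leb2_rectangle // lebesgue_measure_itv /=.
by case: ifP => _; rewrite ?mule0 ?ltry // -EFinD -EFinM ltry.
Qed.

Lemma area_gt0 (R : realType) (U : set (plane R)) : open U -> bounded_set U ->
  U !=set0 -> 0 < area U.
Proof.
by move=> oU bU U0; apply: fine_gt0; rewrite (leb2_gt0 oU U0) (leb2_lty oU bU).
Qed.

Lemma area_ge0 (R : realType) (U : set (plane R)) : 0 <= area U.
Proof. exact: fine_ge0. Qed.

Lemma closed_measurable_plane (R : realType) (A : set (plane R)) : closed A ->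
  measurable (A : set (measurableTypeR R * measurableTypeR R)).
Proof.
move=> cA; rewrite -[A]setCK; apply: measurableC.
by apply: open_measurable_plane; exact: closed_openC.
Qed.

(** A vertical segment lies in the product of a point and the line; any other lies in a line whose
    vertical sections are single points. *)
Lemma segment_negligible (R : realType) (p q : plane R) :
  (leb2 R).-negligible (segment p q).
Proof.
have [pq|npq] := eqVneq p.1 q.1.
  exists ([set p.1] `*` setT); split.
  - by apply: measurableX => //; exact: measurable_set1.
  - by rewrite leb2_rectangle ?lebesgue_measure_set1 ?mul0e //; exact: measurable_set1.
  - by move=> z [t _ <-]; split=> //=; rewrite pq subrr [_ *: _]mulr0 addr0.
pose s := (q.2 - p.2) / (q.1 - p.1).
pose A : set (plane R) := [set z | z.2 - s * z.1 = p.2 - s * p.1].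
have cA : closed A.
  have cf : continuous (fun z : plane R => z.2 - s * z.1).
    move=> z; apply: cvgB; first exact: cvg_snd.
    by apply: cvgM; [exact: cvg_cst|exact: cvg_fst].
  apply: (@preimage_closed _ _ _ [set x | x = p.2 - s * p.1]).
    by move=> z _; exact: cf.
  exact: closed_eq.
exists A; split.
- exact: closed_measurable_plane.
- apply: integral0_eq => x _ /=.
  rewrite [X in lebesgue_measure X](_ : _ = [set p.2 - s * p.1 + s * x]).
    exact: lebesgue_measure_set1.
  apply/seteqP; split=> y; rewrite /xsection /= inE /A /= => e; lra.
- move=> z [t _ <-].
  change (p.2 + t * (q.2 - p.2) - s * (p.1 + t * (q.1 - p.1)) = p.2 - s * p.1).
  rewrite /s; field.
  by rewrite subr_eq0 eq_sym.
Qed.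

Lemma dot_ge0 (R : realType) (v : plane R) : 0 <= dot v v.
Proof. by rewrite /dot addr_ge0 // -expr2 sqr_ge0. Qed.

Lemma enorm_sqr (R : realType) (v : plane R) : enorm v ^+ 2 = dot v v.
Proof. by rewrite /enorm sqr_sqrtr ?dot_ge0. Qed.

Lemma enorm_ge0 (R : realType) (v : plane R) : 0 <= enorm v.
Proof. exact: sqrtr_ge0. Qed.

#[local] Instance leb2_ae_filter (R : realType) :
  Filter (nbhs (almost_everywhere (leb2 R))) := ae_filter_ringOfSetsType (leb2 R).

Lemma Rintegral_ae_eq d (T : measurableType d) (R : realType)
    (mu : {measure set T -> \bar R}) (D : set T) (f g : T -> R) :
  {ae mu, forall x, D x -> f x = g x} ->
  \int[mu]_(x in D) f x = \int[mu]_(x in D) g x.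
Proof.
move=> fg; congr fine; apply: integral_ae_eq.
by apply: filterS fg => x h /h ->.
Qed.

(** It replaces a coefficient of the tensor, bounded only almost everywhere, by a function bounded
    everywhere, which is integrable on sets of finite measure. The absolute value covers a negative
    [M]. *)
Lemma lebesgue_measurable_truncate (R : realType) (Omega : set (plane R))
    (f : plane R -> R) (M : R) : lebesgue_measurable_fun Omega f ->
    {ae leb2 R, forall x, Omega x -> `|f x| <= M} ->
  exists g : measurableTypeR R * measurableTypeR R -> R,
    [/\ measurable_fun Omega g, forall x, `|g x| <= `|M| &
        {ae leb2 R, forall x, Omega x -> f x = g x}].
Proof.
move=> [g mg fg] fM.
exists (fun x => Num.max (- `|M|) (Num.min `|M| (g x))); split.
- by apply: measurable_maxr => //; apply: measurable_minr.
- move=> x; rewrite ler_norml le_max lexx /= ge_max.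
  by rewrite ge_min lexx andbT; have := normr_ge0 M; lra.
- apply: filterS2 fg fM => x h1 h2 Ox; rewrite -(h1 Ox).
  have := h2 Ox; rewrite ler_norml => /andP[l u]; have lM := ler_norm M.
  by rewrite (min_idPr _) ?(max_idPr _) //; lra.
Qed.

Lemma bounded_setS (R : realType) (A B : set (plane R)) : A `<=` B ->
  bounded_set B -> bounded_set A.
Proof.
by move=> AB [M [Mr hM]]; exists M; split=> // N MN x /AB; exact: hM.
Qed.

Section BoundedMeasurable.
Context d (T : measurableType d) (R : realType) (mu : {measure set T -> \bar R}).
Context (D : set T).
Hypothesis mD : measurable D.
Hypothesis muD : (mu D < +oo)%E.

Definition bounded_measurable (f : T -> R) : Prop :=
  measurable_fun D f /\ exists M, forall x, `|f x| <= M.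

Lemma bounded_measurable_integrable f : bounded_measurable f ->
  mu.-integrable D (EFin \o f).
Proof.
move=> [mf [M hM]]; apply: measurable_bounded_integrable => //.
by exists M; split; [exact: num_real|move=> x Mx y _; exact: le_trans (hM y) (ltW Mx)].
Qed.

Lemma bounded_measurable_cst c : bounded_measurable (fun=> c).
Proof. by split=> //; exists `|c|. Qed.

Lemma bounded_measurableD f g : bounded_measurable f -> bounded_measurable g ->
  bounded_measurable (fun x => f x + g x).
Proof.
move=> [mf [M hM]] [mg [N hN]]; split; first exact: measurable_funD.
by exists (M + N) => x; apply: le_trans (ler_normD _ _) (lerD _ _).
Qed.

Lemma bounded_measurableZ c f : bounded_measurable f ->
  bounded_measurable (fun x => c * f x).
Proof.
move=> [mf [M hM]]; split; first by apply: measurable_funM.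
by exists (`|c| * M) => x; rewrite normrM ler_wpM2l.
Qed.

End BoundedMeasurable.

(** The pointwise ellipticity is integrated for a fixed vector [v]; up to the factor [(area D)^-1],
    [J] is the tensor averaged over a diamond. *)
Lemma Rintegral_quadratic_form (R : realType) (Omega D : set (plane R))
    (Lambda : plane R -> 'M[R]_2) :
    admissible_tensor Omega Lambda -> open Omega -> bounded_set Omega ->
    open D -> D `<=` Omega ->
  let J i j := \int[leb2 R]_(x in D) (Lambda x i j) in
  J 0 1 = J 1 0 /\ exists2 lam, 0 < lam & forall v : plane R,
    lam * area D * dot v v <=
    (J 0 0 * v.1 + J 0 1 * v.2) * v.1 + (J 1 0 * v.1 + J 1 1 * v.2) * v.2.
Proof.
move=> [mL [M LM] Lsym [lam [Lam [lam0 _ Lpos]]]] oO bO oD DO J.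
have mO : measurable (Omega : set (measurableTypeR R * measurableTypeR R)).
  exact: open_measurable_plane.
have mD : measurable (D : set (measurableTypeR R * measurableTypeR R)).
  exact: open_measurable_plane.
have D_fin : (leb2 R D < +oo)%E.
  apply: leb2_lty => //; exact: bounded_setS DO bO.
pose bm := @bounded_measurable _ _ R (D : set (measurableTypeR R * measurableTypeR R)).
have trunc i j : exists g : measurableTypeR R * measurableTypeR R -> R,
    bm g /\ {ae leb2 R, forall x, D x -> Lambda x i j = g x}.
  have [|g [mg gM Lg]] := @lebesgue_measurable_truncate R Omega (fun x => Lambda x i j) M (mL i j).
    by apply: filterS LM => x h /h.
  exists g; split; last by apply: filterS Lg => x h /DO/h.
  by split; [exact: measurable_funS mg|exists `|M|].
have [g00 [b00 L00]] := trunc 0 0; have [g01 [b01 L01]] := trunc 0 1.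
have [g10 [b10 L10]] := trunc 1 0; have [g11 [b11 L11]] := trunc 1 1.
split.
  apply: Rintegral_ae_eq; apply: filterS Lsym => x h /DO/h.
  by move=> /matrixP/(_ 1 0); rewrite mxE.
exists lam => // v.
have -> : J 0 0 = \int[leb2 R]_(x in D) g00 x by exact: Rintegral_ae_eq.
have -> : J 0 1 = \int[leb2 R]_(x in D) g01 x by exact: Rintegral_ae_eq.
have -> : J 1 0 = \int[leb2 R]_(x in D) g10 x by exact: Rintegral_ae_eq.
have -> : J 1 1 = \int[leb2 R]_(x in D) g11 x by exact: Rintegral_ae_eq.
pose h x := (v.1 ^+ 2 * g00 x + v.1 * v.2 * g01 x) + ((v.1 * v.2 * g10 x + v.2 ^+ 2 * g11 x) + - (lam * dot v v)).
have hE : \int[leb2 R]_(x in D) h x =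
    v.1 ^+ 2 * \int[leb2 R]_(x in D) g00 x + v.1 * v.2 * \int[leb2 R]_(x in D) g01 x +
    (v.1 * v.2 * \int[leb2 R]_(x in D) g10 x + v.2 ^+ 2 * \int[leb2 R]_(x in D) g11 x +
     - (lam * dot v v) * area D).
  have bI (g : measurableTypeR R * measurableTypeR R -> R) : bm g ->
      (leb2 R).-integrable D (EFin \o g).
    exact: (bounded_measurable_integrable mD D_fin).
  have bD f g : bm f -> bm g -> bm (fun x => f x + g x) by exact: bounded_measurableD.
  have bZ c g : bm g -> bm (fun x => c * g x) by exact: bounded_measurableZ.
  have bC c : bm (fun=> c) by exact: bounded_measurable_cst.
  have bq a b p q : bm p -> bm q -> bm (fun x => a * p x + b * q x).
    by move=> bp bq; apply: bD; exact: bZ.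
  rewrite /h !RintegralD //; try by apply: bI; do ?[exact: bC|exact: bZ|exact: bq].
    by rewrite !RintegralZl ?Rintegral_cst //; exact: bI.
  by apply: bI; apply: (bD _ (fun=> - (lam * dot v v))); [exact: bq|exact: bC].
have h0 : 0 <= \int[leb2 R]_(x in D) h x.
  (* The function [h] is nonnegative only almost everywhere, hence the detour by its positive
     part. *)
  rewrite (@Rintegral_ae_eq _ _ _ _ _ _ (fun x => Num.max 0 (h x))).
    by apply: Rintegral_ge0 => x _; rewrite le_max lexx.
  apply: filterS (filterI (filterI L00 L01) (filterI (filterI L10 L11) Lpos)).
  move=> x [[l00 l01] [[l10 l11] lp]] Dx; apply/esym/max_idPr.
  have /andP[+ _] := lp (DO _ Dx) v.
  rewrite enorm_sqr /h -(l00 Dx) -(l01 Dx) -(l10 Dx) -(l11 Dx) /dot /mxapp /=; lra.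
by move: h0; rewrite hE; lra.
Qed.

(** * Geometry of the mesh *)

(** Parallel unit normals have parallel tangents, and this is the equality case of Cauchy-Schwarz.
    In the proof, [al] and [be] are the coordinates of [s] and [t] along the normals rotated by a
    right angle. *)
Lemma orthogonal_collinear (R : realType) (n k s t : plane R) :
    dot n n = 1 -> dot k k = 1 -> dot n s = 0 -> dot k t = 0 ->
    dot n k ^+ 2 = 1 ->
  dot t s ^+ 2 = dot t t * dot s s.
Proof.
case: n k s t => [n1 n2] [k1 k2] [s1 s2] [t1 t2]; rewrite /dot /= => nn kk ns kt nk.
have cr : n1 * k2 - n2 * k1 = 0.
  apply/eqP; rewrite -sqrf_eq0; apply/eqP.
  have -> : (n1 * k2 - n2 * k1) ^+ 2 = (n1 * n1 + n2 * n2) * (k1 * k1 + k2 * k2) -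
     (n1 * k1 + n2 * k2) ^+ 2 by ring.
  by rewrite nn kk nk mulr1 subrr.
pose al := s2 * n1 - s1 * n2; pose be := t2 * k1 - t1 * k2.
have e1 : s1 = - al * n2.
  rewrite -[LHS]mulr1 -nn; apply/eqP; rewrite -subr_eq0; apply/eqP.
  have -> : s1 * (n1 * n1 + n2 * n2) - - al * n2 = n1 * (n1 * s1 + n2 * s2) by rewrite /al; ring.
  by rewrite ns mulr0.
have e2 : s2 = al * n1.
  rewrite -[LHS]mulr1 -nn; apply/eqP; rewrite -subr_eq0; apply/eqP.
  have -> : s2 * (n1 * n1 + n2 * n2) - al * n1 = n2 * (n1 * s1 + n2 * s2) by rewrite /al; ring.
  by rewrite ns mulr0.
have e3 : t1 = - be * k2.
  rewrite -[LHS]mulr1 -kk; apply/eqP; rewrite -subr_eq0; apply/eqP.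
  have -> : t1 * (k1 * k1 + k2 * k2) - - be * k2 = k1 * (k1 * t1 + k2 * t2) by rewrite /be; ring.
  by rewrite kt mulr0.
have e4 : t2 = be * k1.
  rewrite -[LHS]mulr1 -kk; apply/eqP; rewrite -subr_eq0; apply/eqP.
  have -> : t2 * (k1 * k1 + k2 * k2) - be * k1 = k2 * (k1 * t1 + k2 * t2) by rewrite /be; ring.
  by rewrite kt mulr0.
have cr2 : s1 * t2 - s2 * t1 = 0.
  rewrite e1 e2 e3 e4.
  have -> : - al * n2 * (be * k1) - al * n1 * (- be * k2) = al * be * (n1 * k2 - n2 * k1) by ring.
  by rewrite cr mulr0.
have -> : (t1 * t1 + t2 * t2) * (s1 * s1 + s2 * s2) =
  (t1 * s1 + t2 * s2) ^+ 2 + (s1 * t2 - s2 * t1) ^+ 2 by ring.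
by rewrite cr2 expr0n addr0.
Qed.

(** Since the inverse of 0 is 0, each degeneracy (a zero length, or parallel diagonals with
    [sin (alpha e) = 0]) makes [theta e] vanish, against [1 <= theta e]. *)
Lemma edge_nondegenerate (R : realType) (m : ddfv_data R) (e : edge m) :
    1 <= theta e ->
    dot (nK e) (nK e) = 1 -> dot (nKs e) (nKs e) = 1 ->
    dot (nK e) (vpos (eLs e) - vpos (eKs e)) = 0 ->
    dot (nKs e) (cell_center (eL e) - cell_center (inl (eK e))) = 0 ->
  [/\ 0 < m_sigma e, 0 < m_sigma_star e & `|dot (nK e) (nKs e)| < 1].
Proof.
move=> th nn kk ns kt.
have th0 : theta e != 0 by apply: contraTN th => /eqP->; rewrite ler10.
have s0 : 0 < m_sigma e.
  rewrite lt_neqAle eq_sym enorm_ge0 andbT; apply: contra_neq th0 => s0.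
  by rewrite /theta s0 mul0r invr0 mulr0 addr0 mulr0.
have t0 : 0 < m_sigma_star e.
  rewrite lt_neqAle eq_sym enorm_ge0 andbT; apply: contra_neq th0 => t0.
  by rewrite /theta t0 mul0r invr0 mulr0 addr0 mulr0.
split=> //; set c := dot _ _.
have c1 : c ^+ 2 <= 1.
  have -> : 1 = dot (nK e) (nK e) * dot (nKs e) (nKs e) by rewrite nn kk mulr1.
  rewrite -subr_ge0.
  have -> : dot (nK e) (nK e) * dot (nKs e) (nKs e) - c ^+ 2 =
     ((nK e).1 * (nKs e).2 - (nK e).2 * (nKs e).1) ^+ 2 by rewrite /c /dot; ring.
  exact: sqr_ge0.
have : c ^+ 2 != 1.
  apply: contra_neq th0 => cE.
  have := orthogonal_collinear nn kk ns kt cE.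
  rewrite -!enorm_sqr -/(m_sigma e) -/(m_sigma_star e) => h.
  pose q := dot (cell_center (eL e) - cell_center (inl (eK e))) (vpos (eLs e) - vpos (eKs e)) /
    (m_sigma_star e * m_sigma e).
  have q2 : q ^+ 2 = 1.
    by rewrite /q expr_div_n h exprMn divff // mulf_neq0 // sqrf_eq0 gt_eqF.
  have sin0 : sin (alpha e) = 0.
    rewrite /alpha -/q; move/eqP: q2; rewrite sqrf_eq1 => /orP[]/eqP->.
      by rewrite acos1 sin0.
    by rewrite acosN1 sinpi.
  by rewrite /theta sin0 mulr0 invr0 mul0r.
move=> c2; have {c1 c2} : c ^+ 2 < 1 by rewrite lt_neqAle c2.
move=> h; rewrite -(@ltr_pXn2r R 2) ?nnegrE ?normr_ge0 ?ler01 //.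
by rewrite expr1n real_normK ?num_real.
Qed.

Lemma quadratic_form_lower (R : realType) (a b c : R) : 0 < a -> 0 < b -> `|c| < 1 ->
  exists2 k, 0 < k & forall x y : R,
    k * (x ^+ 2 + y ^+ 2) <= (a * x) ^+ 2 + 2 * c * (a * x) * (b * y) + (b * y) ^+ 2.
Proof.
move=> a0 b0 c1; pose r := Num.min (a ^+ 2) (b ^+ 2).
have r0 : 0 < r by rewrite lt_min !exprn_gt0.
have ra : r <= a ^+ 2 by rewrite ge_min lexx.
have rb : r <= b ^+ 2 by rewrite ge_min lexx orbT.
have c0 : 0 < 1 - `|c| by rewrite subr_gt0.
exists ((1 - `|c|) * r); first by rewrite mulr_gt0.
move=> x y; apply: (@le_trans _ _ ((1 - `|c|) * ((a * x) ^+ 2 + (b * y) ^+ 2))).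
  rewrite -mulrA ler_pM2l // mulrDr !exprMn.
  by apply: lerD; rewrite ler_wpM2r // sqr_ge0.
have := ler_norm c; have := ler_norm (- c); rewrite normrN.
move: `|c| => d; set X := a * x; set Y := b * y => h1 h2.
(* The two squares add up to twice [d * (X ^+ 2 + Y ^+ 2) + 2 * c * X * Y], which bounds the cross
   term. *)
have : 0 <= (d + c) * (X + Y) ^+ 2 by rewrite mulr_ge0 ?sqr_ge0 //; lra.
have : 0 <= (d - c) * (X - Y) ^+ 2 by rewrite mulr_ge0 ?sqr_ge0 //; lra.
nra.
Qed.

(** The form of [AD] at [w] is that of the averaged tensor at [z], a combination of the two normals
    proportional to the discrete gradient when [w] is [deltaD g e]. As the normals are not parallel,
    [z] controls [w]. *)
Lemma AD_quadratic (R : realType) (m : ddfv_data R) (Lambda : plane R -> 'M[R]_2)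
    (e : edge m) (lam : R) : 0 < m_diam e ->
    0 < m_sigma e -> 0 < m_sigma_star e -> `|dot (nK e) (nKs e)| < 1 ->
    dot (nK e) (nK e) = 1 -> dot (nKs e) (nKs e) = 1 ->
    0 < lam -> LambdaD Lambda e 0 1 = LambdaD Lambda e 1 0 ->
    (forall v : plane R, lam * dot v v <= dot (mxapp (LambdaD Lambda e) v) v) ->
  exists2 c, 0 < c & forall w : plane R, c * dot w w <= dot w (mxapp (AD Lambda e) w).
Proof.
move=> md s0 t0 c1 nn kk l0 sym hL.
have [k k0 hk] := quadratic_form_lower s0 t0 c1.
have q0 : 0 < (4 * m_diam e)^-1 by rewrite invr_gt0 mulr_gt0.
exists ((4 * m_diam e)^-1 * lam * k); first by rewrite !mulr_gt0.
move=> w; set s := m_sigma e; set t := m_sigma_star e.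
pose z : plane R := (s * w.1 * (nK e).1 + t * w.2 * (nKs e).1,
                     s * w.1 * (nK e).2 + t * w.2 * (nKs e).2).
have -> : dot w (mxapp (AD Lambda e) w) = (4 * m_diam e)^-1 * dot (mxapp (LambdaD Lambda e) z) z.
  rewrite /AD /mxapp /dot !mxE /= -/s -/t /z /=; move: sym; rewrite !mxE /= => ->; ring.
rewrite -!mulrA ler_pM2l //; apply: le_trans (hL z); rewrite ler_pM2l //.
apply: le_trans (_ : k * (w.1 ^+ 2 + w.2 ^+ 2) <= _); first by rewrite /dot -!expr2.
apply: le_trans (hk w.1 w.2) _; rewrite -/s -/t {2}/dot /= -!expr2.
have -> : (s * w.1 * (nK e).1 + t * w.2 * (nKs e).1) ^+ 2 +
    (s * w.1 * (nK e).2 + t * w.2 * (nKs e).2) ^+ 2 =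
  (s * w.1) ^+ 2 * dot (nK e) (nK e) + 2 * dot (nK e) (nKs e) * (s * w.1) * (t * w.2) +
    (t * w.2) ^+ 2 * dot (nKs e) (nKs e) by rewrite /dot; ring.
by rewrite nn kk !mulr1.
Qed.

Lemma enorm_le (R : realType) (v : plane R) : enorm v <= `|v.1| + `|v.2|.
Proof.
rewrite -[leRHS]ger0_norm ?addr_ge0 // -sqrtr_sqr ler_wsqrtr //.
rewrite /dot -!expr2 -(real_normK (num_real v.1)) -(real_normK (num_real v.2)).
have : 0 <= `|v.1| * `|v.2| by rewrite mulr_ge0.
nra.
Qed.

(** Boundedness ensures that [sup] is a true supremum and not its default value. *)
Lemma diameter_gt0 (R : realType) (U : set (plane R)) : open U -> U !=set0 ->
  bounded_set U -> 0 < diameter U.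
Proof.
move=> oU [p Up] /bounded_plane[M UM].
have /nbhs_ballP[e /= e0 eU] : nbhs p U by apply: open_nbhs_nbhs.
pose q : plane R := (p.1 + e / 2, p.2).
have e2 : 0 < e / 2 by rewrite divr_gt0.
have Uq : U q.
  apply: eU; split=> /=; last exact: ballxx.
  rewrite -ball_normE /= opprD addrA subrr add0r normrN gtr0_norm //; lra.
apply: (@lt_le_trans _ _ (enorm (q - p))).
  rewrite /enorm sqrtr_gt0 /dot /= [X in X * X]addrAC subrr add0r subrr mulr0 addr0.
  by rewrite mulr_gt0.
apply: ub_le_sup; last by exists q => //; exists p.
exists (M + M + (M + M)) => _ [x Ux [y Uy <-]].
apply: le_trans (enorm_le _) _; have [x1 x2] := UM x Ux; have [y1 y2] := UM y Uy.
by apply: lerD; apply: le_trans (ler_normB _ _) _; exact: lerD.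
Qed.

Section MeshGeometry.
Context {R : realType} (Omega : set (plane R)) (m : ddfv_data R).
Hypothesis Omega_open : open Omega.
Hypothesis Omega_bounded : bounded_set Omega.
Hypothesis mesh : is_ddfv_mesh Omega m.

Lemma diam_sub (e : edge m) : diam_set e `<=` Omega.
Proof. by case: (diamond_partition mesh) => _ h _; exact: h. Qed.

Lemma cell_sub (K : pcell m) : cell_set K `<=` Omega.
Proof. by case: (primal_partition mesh) => _ h _; exact: h. Qed.

Lemma m_diam_gt0 (e : edge m) : 0 < m_diam e.
Proof.
have P := diamond_polygon mesh e.
apply: area_gt0; [exact: polygon_open P|exact: polygon_bounded P|].
exact: polygon_nonempty P.
Qed.

Lemma AD_coercive_mesh (Lambda : plane R -> 'M[R]_2) (thetastar : R) (e : edge m) :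
    admissible_tensor Omega Lambda -> regular_mesh m thetastar ->
  exists2 c, 0 < c & forall w : plane R, c * dot w w <= dot w (mxapp (AD Lambda e) w).
Proof.
move=> aL reg; have [nn ns _] := nK_normal mesh e; have [kk kt _] := nKs_normal mesh e.
have [/andP[th _] _] := reg e.
have [s0 t0 c1] := edge_nondegenerate th nn kk ns kt.
have P := diamond_polygon mesh e.
have [sym [lam lam0 hL]] := Rintegral_quadratic_form aL Omega_open Omega_bounded
  (polygon_open P) (@diam_sub e).
have md := m_diam_gt0 e.
apply: (@AD_quadratic R m Lambda e lam) => //.
  by rewrite !mxE sym.
move=> v; have := hL v; rewrite -/(m_diam e) => h.
rewrite {2}/dot /mxapp /= !mxE.
apply: le_trans (_ : (m_diam e)^-1 * (lam * m_diam e * dot v v) <= _).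
  by rewrite [leRHS](_ : _ = lam * dot v v) //; field; rewrite gt_eqF.
rewrite -(ler_pM2l (_ : 0 < (m_diam e)^-1)) ?invr_gt0 // in h.
by apply: le_trans h _; rewrite le_eqVlt; apply/orP; left; apply/eqP; ring.
Qed.

(** A point of [Omega] gives a cell, a cell has a vertex, and a vertex belongs to an edge, whose
    diamond has a positive diameter. *)
Lemma mesh_size_gt0 : Omega !=set0 -> 0 < mesh_size m.
Proof.
move=> [p Op]; have [_ _ /(_ p Op)[K _ _]] := primal_partition mesh.
have [s [P _ _]] := primal_polygon mesh K.
have [e _] : exists e : edge m, True.
  have := polygon_size P; case: s {P} => // v s _.
  by have [e _] := vertex_edge mesh v; exists e.
have {}P := diamond_polygon mesh e.
apply: (@lt_le_trans _ _ (diameter (diam_set e))); last exact: le_bigmax.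
apply: diameter_gt0; [exact: polygon_open P| |exact: polygon_bounded P].
exact: polygon_nonempty P.
Qed.

End MeshGeometry.

(** * Connectedness of the overlap graph *)

Lemma segmentC (R : realType) (p q : plane R) : segment p q = segment q p.
Proof.
suff h (a b : plane R) : segment a b `<=` segment b a by apply/seteqP.
move=> _ [t /= + <-]; rewrite in_itv /= => /andP[t0 t1].
exists (1 - t); first by rewrite /= in_itv /=; apply/andP; split; lra.
by rewrite scalerBl scale1r -[b - a]opprB scalerN addrA [b + _]addrC subrK.
Qed.

Lemma segment_left (R : realType) (p q : plane R) : segment p q p.
Proof. by exists 0; rewrite ?scale0r ?addr0 //= in_itv /= lexx ler01. Qed.

Lemma segment_cases (R : realType) (p q z : plane R) : segment p q z ->
  [\/ z = p, z = q | open_segment p q z].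
Proof.
move=> [t /= + <-]; rewrite in_itv /= => /andP[t0 t1].
have [->|n0] := eqVneq t 0; first by constructor 1; rewrite scale0r addr0.
have [->|n1] := eqVneq t 1; first by constructor 2; rewrite scale1r addrC subrK.
constructor 3; exists t => //=; rewrite in_itv /=.
by rewrite !lt_neqAle eq_sym n0 t0 n1 t1.
Qed.

Lemma frontier_sub_closure (T : topologicalType) (A : set T) : frontier A `<=` closure A.
Proof. by move=> x []. Qed.

Lemma polygon_vertex_closure (R : realType) (s : seq (plane R)) (P : set (plane R)) p :
  is_polygon s P -> p \in s -> closure P p.
Proof.
move=> sP ps; apply: frontier_sub_closure; rewrite (polygon_frontier sP).
by exists p => //; exact: segment_left.
Qed.

Section MeshConnectivity.
Context {R : realType} (Omega : set (plane R)) (m : ddfv_data R).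
Hypothesis Omega_bounded : bounded_set Omega.
Hypothesis Omega_connected : connected Omega.
Hypothesis mesh : is_ddfv_mesh Omega m.
Implicit Types (K : pcell m) (v : vertex m) (e : edge m).

Lemma cell_open K : open (cell_set K).
Proof. by have [s [P _ _]] := primal_polygon mesh K; exact: polygon_open P. Qed.

Lemma cell_frontier K p : frontier (cell_set K) p ->
  exists2 e, inl K \in sides e & sigma e p.
Proof.
have [s [P hs _]] := primal_polygon mesh K.
rewrite (polygon_frontier P) => -[_ /mapP[v vs ->]].
rewrite (next_map (vpos_inj mesh) (map_uniq (polygon_uniq P))).
have [e Ke ee] := hs v vs => pseg; exists e => //.
rewrite /sigma; move: ee; rewrite /ends => /setP ee.
have := ee (eKs e); have := ee (eLs e); rewrite !inE !eqxx orbT /=.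
have := edge_ends mesh e.
move=> ne /esym/orP[]/eqP e1 /esym/orP[]/eqP e2.
- by rewrite e1 e2 eqxx in ne.
- by rewrite e1 e2 segmentC.
- by rewrite e1 e2.
- by rewrite e1 e2 eqxx in ne.
Qed.

Lemma edge_end_closure K e v : inl K \in sides e -> v \in ends e ->
  closure (cell_set K) (vpos v).
Proof.
have [s [P _ hs]] := primal_polygon mesh K => /hs[w ws ->].
rewrite !inE => /orP[]/eqP->; apply: (polygon_vertex_closure P); apply: map_f => //.
by rewrite mem_next.
Qed.

(** Every vertex lies in the closure of [Omega], being an end of an edge of some cell; so one of the
    interior and boundary descriptions applies, and in both the centers of the surrounding cells are
    vertices of the dual polygon. *)
Lemma dual_polygon v : exists2 s, is_polygon s (dual_set v) &
  forall K, closure (cell_set K) (vpos v) -> cell_center (inl K) \in s.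
Proof.
have [e ve] := vertex_edge mesh v.
have Ov : closure Omega (vpos v).
  apply: (closure_subset (@cell_sub _ _ _ mesh (eK e))).
  by apply: (edge_end_closure (e := e)) => //; rewrite /sides !inE eqxx.
have [vO|vO] := pselect (Omega (vpos v)).
  have [s [_ hs _ P]] := dual_interior mesh vO; exists (map (@cell_center R m) s) => //.
  by move=> K /(hs (inl K)); exact: map_f.
have [|s [_ hs _ P]] := dual_boundary mesh (v := v).
  by split=> //; move/interior_subset.
exists (vpos v :: map (@cell_center R m) s) => // K /(hs (inl K)) Ks.
by rewrite inE map_f ?orbT.
Qed.

Lemma m_cell_gt0 K : 0 < m_cell K.
Proof.
have [s [P _ _]] := primal_polygon mesh K.
by apply: area_gt0; [exact: polygon_open P|exact: polygon_bounded P|exact: polygon_nonempty P].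
Qed.

Lemma m_dual_gt0 v : 0 < m_dual v.
Proof.
have [s P _] := dual_polygon v.
by apply: area_gt0; [exact: polygon_open P|exact: polygon_bounded P|exact: polygon_nonempty P].
Qed.

Lemma m_cap_gt0 K v : cell_set K `&` dual_set v !=set0 -> 0 < m_cap K v.
Proof.
have [s P _] := dual_polygon v.
move=> ne; apply: area_gt0 => //; first by apply: openI; [exact: cell_open|exact: polygon_open P].
by apply: bounded_setS Omega_bounded => x [Kx _]; exact: (cell_sub mesh Kx).
Qed.

(** The center of [K] is interior to [K] and is a vertex of the dual polygon, hence a limit of
    points of the dual cell. *)
Lemma overlap_vertex K v : closure (cell_set K) (vpos v) -> 0 < m_cap K v.
Proof.
move=> Kv; apply: m_cap_gt0; have [s P hs] := dual_polygon v.
have := polygon_vertex_closure P (hs K Kv).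
move=> /(_ (cell_set K)) [|x [xd xK]]; last by exists x.
by apply: open_nbhs_nbhs; split; [exact: cell_open|exact: (center_cell mesh)].
Qed.

Lemma overlap_dual v : exists K, 0 < m_cap K v.
Proof.
have [s P _] := dual_polygon v; have [p pd] := polygon_nonempty P.
have [_ _ /(_ p (dual_sub mesh pd))[K _ /(_ (dual_set v))[|x [xK xd]]]] := primal_partition mesh.
  by apply: open_nbhs_nbhs; split=> //; exact: polygon_open P.
by exists K; apply: m_cap_gt0; exists x.
Qed.

(** The point [p] lies on an edge of each cell. If it is an end of one of them, it is the vertex
    sought; otherwise the open edges meet at [p], so the edges coincide and either end will do. *)
Lemma common_vertex K K' p : K <> K' -> Omega p ->
    closure (cell_set K) p -> closure (cell_set K') p ->
  exists2 v : vertex m, closure (cell_set K) (vpos v) & closure (cell_set K') (vpos v).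
Proof.
have front (L L' : pcell m) : L <> L' -> closure (cell_set L) p -> closure (cell_set L') p ->
    frontier (cell_set L) p.
  move=> nLL' Lp L'p; split=> // /interior_subset pL.
  have [disj _ _] := primal_partition mesh.
  have [|x [xL' xL]] := L'p (cell_set L).
    by apply: open_nbhs_nbhs; split=> //; exact: cell_open.
  by have : (cell_set L `&` cell_set L') x by []; rewrite (disj _ _ nLL').
move=> nKK' Op Kp K'p.
have [e Ke ep] := cell_frontier (front _ _ nKK' Kp K'p).
have [e' Ke' ep'] := cell_frontier (front _ _ (nesym nKK') K'p Kp).
have eK v : v \in ends e -> p = vpos v ->
  exists2 v : vertex m, closure (cell_set K) (vpos v) & closure (cell_set K') (vpos v).
  by move=> ve pv; exists v; [exact: edge_end_closure Ke ve|rewrite -pv].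
have eK' v : v \in ends e' -> p = vpos v ->
  exists2 v : vertex m, closure (cell_set K) (vpos v) & closure (cell_set K') (vpos v).
  by move=> ve pv; exists v; [rewrite -pv|exact: edge_end_closure Ke' ve].
have [pv|pv|op] := segment_cases ep.
- by apply: eK pv; rewrite !inE eqxx.
- by apply: eK pv; rewrite !inE eqxx orbT.
have [pv|pv|op'] := segment_cases ep'.
- by apply: eK' pv; rewrite !inE eqxx.
- by apply: eK' pv; rewrite !inE eqxx orbT.
have ee' : e = e'.
  apply/eqP; apply: contraT => /(edge_disjoint mesh) d.
  by have : (open_sigma e `&` open_sigma e') p by []; rewrite d.
have eKe : eKs e \in ends e by rewrite !inE eqxx.
exists (eKs e); first exact: edge_end_closure Ke eKe.
by apply: edge_end_closure eKe; rewrite ee'.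
Qed.

(** The closures of the cells satisfying [P] and those of the other cells form two closed sets that
    cover [Omega] and do not meet in it, since [common_vertex] would carry [P] across. Dual cells
    are reached by [overlap_dual]. *)
Lemma overlap_connected (P : bulk m -> Prop) :
    (forall K v, 0 < m_cap K v -> P (inl K) <-> P (inr v)) ->
  forall x y, P x -> P y.
Proof.
move=> Pstep.
have Pcom K K' p : Omega p -> closure (cell_set K) p -> closure (cell_set K') p ->
    P (inl K) -> P (inl K').
  move=> Op Kp K'p; have [<-//|/eqP nKK'] := eqVneq K K'.
  have [v /overlap_vertex Kv /overlap_vertex K'v] := common_vertex nKK' Op Kp K'p.
  by move=> /(Pstep _ _ Kv)/(Pstep _ _ K'v).
have cO K : Omega (cell_center (inl K)) by apply: (cell_sub mesh); exact: (center_cell mesh).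
have cK K : closure (cell_set K) (cell_center (inl K)).
  by apply: subset_closure; exact: (center_cell mesh).
have cover p : Omega p -> exists K, closure (cell_set K) p.
  by have [_ _ h] := primal_partition mesh => /h[K _ Kp]; exists K.
have closedU (Q : set (pcell m)) : closed (\bigcup_(K in Q) closure (cell_set K)).
  by apply: closed_bigcup => [|K _]; [exact: finite_finset|exact: closed_closure].
have Pcell K K' : P (inl K) -> P (inl K').
  move=> PK; pose Q := [set K | P (inl K)].
  have QE : Omega `&` \bigcup_(K in Q) closure (cell_set K) = Omega.
    apply: Omega_connected.
    - by exists (cell_center (inl K)); split=> //; exists K.
    - exists (~` \bigcup_(K in ~` Q) closure (cell_set K)); first exact: closed_openC.
      apply/seteqP; split=> p [Op]; last first.
        have [L Lp] := cover p Op => nQ; split=> //; exists L => //.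
        by apply: contrapT => nPL; apply: nQ; exists L.
      move=> [L PL Lp]; split=> // -[L' nPL' L'p]; apply: nPL'.
      exact: Pcom Lp L'p PL.
    - by exists (\bigcup_(K in Q) closure (cell_set K)).
  have : Omega (cell_center (inl K')) by [].
  by rewrite -[X in X _ -> _]QE => -[Oc [L PL Lc]]; exact: Pcom Oc Lc (cK K') PL.
have toCell x : exists K, P x <-> P (inl K).
  case: x => [K|v]; first by exists K.
  by have [K Kv] := overlap_dual v; exists K; have [h1 h2] := Pstep _ _ Kv; split.
move=> x y Px; have [K xK] := toCell x; have [K' yK'] := toCell y.
by apply/yK'; apply: (Pcell K); apply/xK.
Qed.

End MeshConnectivity.

(** * Initial data *)

Lemma entropyH_ge0 (R : realType) (s : R) : 0 <= s -> 0 <= entropyH s.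
Proof.
by move=> s0; have := entropyH_convex s0 ltr01; rewrite {1}/entropyH ln1; lra.
Qed.

(** The tangent at [expR 1], of slope 1: finite entropy thus gives integrability on a bounded
    set. *)
Lemma le_entropyH (R : realType) (s : R) : 0 <= s -> s <= entropyH s + expR 1.
Proof.
move=> s0; have := entropyH_convex s0 (expR_gt0 1); rewrite {1}/entropyH expRK.
by have := expR_gt0 (1 : R); lra.
Qed.

Lemma near_all_seq (T : Type) (F : set_system T) {FF : Filter F} (I : eqType)
    (s : seq I) (P : I -> T -> Prop) : (forall i, \forall x \near F, P i x) ->
  \forall x \near F, forall i, i \in s -> P i x.
Proof.
move=> FP; elim: s => [|i s IH]; first by apply: nearW.
apply: filterS2 (FP i) IH => x Pi Ps j; rewrite inE => /predU1P[->//|]; exact: Ps.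
Qed.

Section InitialData.
Context {R : realType} (Omega : set (plane R)) (u0 : plane R -> R).
Hypothesis Omega_open : open Omega.
Hypothesis Omega_bounded : bounded_set Omega.
Hypothesis u0_admissible : admissible_initial Omega u0.

Lemma initial_density_borel : exists g : measurableTypeR R * measurableTypeR R -> R,
  [/\ measurable_fun Omega g, forall x, 0 <= g x,
      {ae leb2 R, forall x, Omega x -> u0 x = g x},
      (0 < \int[leb2 R]_(x in Omega) (g x)%:E)%E &
      (\int[leb2 R]_(x in Omega) (g x)%:E < +oo)%E].
Proof.
have [[g mg u0g] u0_ge0 u0_pos u0_H] := u0_admissible.
pose h x := Num.max 0 (g x).
have mO : measurable (Omega : set (measurableTypeR R * measurableTypeR R)).
  exact: open_measurable_plane.
have h0 x : 0 <= h x by rewrite le_max lexx.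
have mh : measurable_fun Omega h by apply: measurable_maxr.
have u0h : {ae leb2 R, forall x, Omega x -> u0 x = h x}.
  apply: filterS u0g => x e Ox; rewrite /h -(e Ox); apply/esym/max_idPr; exact: u0_ge0.
exists h; split=> //.
  have -> : (\int[leb2 R]_(x in Omega) (h x)%:E = \int[leb2 R]_(x in Omega) (u0 x)%:E)%E.
    by apply: integral_ae_eq; apply: filterS u0h => x e /e ->.
  by [].
have mH : measurable_fun Omega (fun x => entropyH (h x)).
  apply: measurable_funD => //; apply: measurable_funB => //.
  by apply: measurable_funM => //; apply: measurableT_comp => //; exact: measurable_ln.
apply: (@le_lt_trans _ _ (\int[leb2 R]_(x in Omega) ((entropyH (h x))%:E + (expR 1)%:E))%E).
  apply: ge0_le_integral => //.
  - by move=> x _; rewrite lee_fin.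
  - exact/measurable_EFinP.
  - by apply: emeasurable_funD => //; exact/measurable_EFinP.
  - by move=> x _; rewrite -EFinD lee_fin le_entropyH.
rewrite ge0_integralD //.
- rewrite integral_cst // lte_add_pinfty //; last first.
    by rewrite lte_mul_pinfty ?lee_fin ?expR_ge0 // leb2_lty.
  have -> : (\int[leb2 R]_(x in Omega) (entropyH (h x))%:E =
      \int[leb2 R]_(x in Omega) (entropyH (u0 x))%:E)%E.
    by apply: integral_ae_eq; apply: filterS u0h => x e /e ->.
  by [].
- by move=> x _; rewrite lee_fin entropyH_ge0.
- exact/measurable_EFinP.
Qed.

Context (m : ddfv_data R).
Hypothesis mesh : is_ddfv_mesh Omega m.

Lemma u_init_ge0 (x : bulk m) : 0 <= u_init u0 (unk x).
Proof.
have [_ u0_ge0 _ _] := u0_admissible.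
case: x => [K|v] /=; rewrite mulr_ge0 ?invr_ge0 ?area_ge0 // Rintegral_ge0 // => x xK;
  apply: u0_ge0; [exact: (cell_sub mesh) xK|exact: (dual_sub mesh) xK].
Qed.

(** If all the integrals over primal cells vanished, the density would be zero almost everywhere in
    the cells; their frontiers are finite unions of segments, so its integral over [Omega] would
    vanish. *)
Lemma u_init_gt0 : exists x : bulk m, 0 < u_init u0 (unk x).
Proof.
have [g [mg g0 u0g g_pos g_fin]] := initial_density_borel.
have mO : measurable (Omega : set (measurableTypeR R * measurableTypeR R)).
  exact: open_measurable_plane.
have mK (K : pcell m) : measurable (cell_set K : set (measurableTypeR R * measurableTypeR R)).
  by apply: open_measurable_plane; exact: (cell_open mesh).
have mgK (K : pcell m) :
    measurable_fun (cell_set K : set (measurableTypeR R * measurableTypeR R)) g.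
  exact: (measurable_funS mO (@cell_sub _ _ _ mesh K) mg).
have EK (K : pcell m) : (\int[leb2 R]_(x in cell_set K) (u0 x)%:E = \int[leb2 R]_(x in cell_set K) (g x)%:E)%E.
  apply: integral_ae_eq; apply: filterS u0g => x e xK.
  by rewrite (e (@cell_sub _ _ _ mesh K x xK)).
(* Finiteness matters: [fine] sends an infinite integral to 0. *)
have finK (K : pcell m) : (\int[leb2 R]_(x in cell_set K) (g x)%:E < +oo)%E.
  apply: le_lt_trans g_fin; apply: ge0_subset_integral => //.
  - exact/measurable_EFinP.
  - by move=> x _; rewrite lee_fin.
  - exact: (@cell_sub _ _ _ mesh K).
have [[K posK]|noK] := pselect (exists K : pcell m, (0 < \int[leb2 R]_(x in cell_set K) (g x)%:E)%E).
  exists (inl K); rewrite /= mulr_gt0 ?invr_gt0 ?(m_cell_gt0 mesh) //.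
  by rewrite /Rintegral EK fine_gt0 // posK finK.
exfalso; move: g_pos; apply/negP; rewrite -leNgt.
have zeroK (K : pcell m) : {ae leb2 R, forall x, cell_set K x -> g x = 0}.
  have : (\int[leb2 R]_(x in cell_set K) `|(g x)%:E| = 0)%E.
    apply/eqP; rewrite eq_le integral_ge0 // andbT leNgt; apply/negP => pos.
    by apply: noK; exists K; under eq_integral do rewrite -[X in (X%:E)%E]ger0_norm //.
  move/(ae_eq_integral_abs _ (mK K) ((measurable_EFinP _ _).2 (mgK K))).1.
  by apply: filterS => x h /h [].
have frontK (K : pcell m) : {ae leb2 R, forall x, ~ frontier (cell_set K) x}.
  have [s [P _ _]] := primal_polygon mesh K; rewrite (polygon_frontier P).
  have : {ae leb2 R, forall x, forall p, p \in map (@vpos R m) s ->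
      ~ segment p (next (map (@vpos R m) s) p) x}.
    apply: near_all_seq => p.
    by apply: (negligibleS _ (segment_negligible p (next (map (@vpos R m) s) p))) => x /contrapT.
  by apply: filterS => x h [p /h].
have -> : (\int[leb2 R]_(x in Omega) (g x)%:E = \int[leb2 R]_(x in Omega) (cst 0 x))%E;
  last by rewrite integral0.
apply: integral_ae_eq.
have : {ae leb2 R, forall x, forall K : pcell m, (cell_set K x -> g x = 0) /\ ~ frontier (cell_set K) x}.
  have : {ae leb2 R, forall x, forall K : pcell m, K \in enum (pcell m) ->
      (cell_set K x -> g x = 0) /\ ~ frontier (cell_set K) x}.
    by apply: near_all_seq => K; exact: filterI (zeroK K) (frontK K).
  by move=> hK; apply: filterS hK => x h K; apply: h; rewrite mem_enum.
apply: filterS => x h Ox; have [_ _ /(_ x Ox)[K _ Kx]] := primal_partition mesh.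
have [gx nF] := h K; rewrite gx //.
by apply: contrapT => nKx; apply: nF; split=> //; move/interior_subset.
Qed.

End InitialData.

(** * Iteration in time *)

Lemma ddfv_step_exists (R : realType) (Omega : set (plane R))
    (V : plane R -> R) (Lambda : plane R -> 'M[R]_2)
    (kappa beta thetastar dt : R) (m : ddfv_data R) (u : unknown m -> R) :
    open Omega -> connected Omega -> bounded_set Omega -> Omega !=set0 ->
    admissible_tensor Omega Lambda -> 0 < kappa -> 0 < dt ->
    is_ddfv_mesh Omega m -> regular_mesh m thetastar ->
    (forall x : bulk m, 0 <= u (unk x)) -> (exists x : bulk m, 0 < u (unk x)) ->
  exists w, scheme_step Lambda V kappa beta dt u w /\ entropy_estimate Lambda V dt u w.
Proof.
move=> oO cO bO neO aL kappa0 dt0 mesh reg u0 upos.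
have mass_pos (x : bulk m) : 0 < mass x.
  by case: x => [K|v]; [exact: (m_cell_gt0 mesh)|exact: (m_dual_gt0 mesh)].
have cap0 (K : pcell m) (v : vertex m) : 0 <= m_cap K v by exact: area_ge0.
have AD0 e := AD_coercive_mesh oO bO mesh e aL reg.
have size0 := mesh_size_gt0 mesh neO.
have conn := overlap_connected bO cO mesh.
have [w sw] := scheme_step_ex V beta mass_pos cap0 conn AD0 size0 kappa0 dt0 u0 upos.
by exists w; split=> //; exact: (scheme_step_entropy mass_pos cap0 size0 kappa0 dt0 u0 sw).
Qed.

Theorem theorem2p1 (R : realType) (Omega : set (plane R)) (T : R)
    (u0 V : plane R -> R) (Lambda : plane R -> 'M[R]_2)
    (kappa beta thetastar : R) (m : ddfv_data R) (NT : nat) :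
  polygonal Omega -> connected Omega -> open Omega -> bounded_set Omega ->
  0 < T ->
  admissible_initial Omega u0 ->
  admissible_potential Omega V ->
  admissible_tensor Omega Lambda ->
  0 < kappa -> 0 < beta < 2 ->
  is_ddfv_mesh Omega m -> regular_mesh m thetastar ->
  (1 <= NT)%N ->
  let dt := T / NT%:R in
  let step := @scheme_step R m Lambda V kappa beta dt in
  let estimate := @entropy_estimate R m Lambda V dt in
  (forall (n : nat) (u : nat -> unknown m -> R),
     u 0%N = u_init u0 -> (forall k, (k < n)%N -> step (u k) (u k.+1)) ->
     exists w : unknown m -> R, step (u n) w /\ estimate (u n) w) /\
  (exists2 u : nat -> unknown m -> R, u 0%N = u_init u0 &
     forall n : nat, step (u n) (u n.+1) /\ estimate (u n) (u n.+1)).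
Proof.
move=> _ cO oO bO T0 au0 _ aL kappa0 _ mesh reg NT0 dt step estimate.
have dt0 : 0 < dt by rewrite divr_gt0 // ltr0n.
have neO : Omega !=set0.
  apply/set0P/eqP => O0; have [_ _ + _] := au0.
  by rewrite O0 integral_set0 ltxx.
(* The invariant must allow zeros, as the initial data may vanish on some cells; later steps are
   positive everywhere. *)
pose ok (u : unknown m -> R) :=
  (forall x : bulk m, 0 <= u (unk x)) /\ exists x : bulk m, 0 < u (unk x).
have ok0 : ok (u_init u0).
  by split; [exact: (u_init_ge0 au0 mesh)|exact: (u_init_gt0 oO bO au0 mesh)].
have [x0 _] := ok0.2.
have okS u w : step u w -> ok w.
  by move=> [w0 _]; split=> [x|]; [exact: ltW|exists x0].
(* Stated for every [u], with a dummy value when [ok u] fails, so that choice yields a total map to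
   iterate. *)
have next u : exists w, ok u -> step u w /\ estimate u w.
  have [[u_ge0 u_pos]|nok] := pselect (ok u); last by exists u.
  by have [w hw] := ddfv_step_exists V beta oO cO bO neO aL kappa0 dt0 mesh reg u_ge0 u_pos; exists w.
split=> [n u uI uS|].
  have ok_u k : (k <= n)%N -> ok (u k).
    by case: k => [|k] kn; [rewrite uI|exact: okS (uS k kn)].
  by have [w hw] := next (u n); exists w; exact/hw/ok_u.
have [F hF] := choice next.
exists (fun n => iter n F (u_init u0)) => //.
have ok_iter n : ok (iter n F (u_init u0)).
  by elim: n => // n /hF[/okS].
by move=> n; exact/hF/ok_iter.
Qed.
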